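(* There exists a family of smooth non-flat Riemannian metrics $g$ on $\mathbf{R}^n$ which are Euclidean outside a compact set $K$ and which have $N=n(n+1)/2$ invisible directions.
   Context: Let $g$ be a smooth Riemannian metric on $\mathbf{R}^n$ which is the standard Euclidean metric outside a compact set $K$. Geodesics of $g$ outside $K$ are straight lines, and they are deformed somehow inside $K$. The obstacle $K$ is called invisible in the direction $v$, and $v$ is called an invisible direction (direction of invisibility), if every geodesic in the direction $v$ passing the obstacle remains the same straight line, i.e. every geodesic line passing through $K$ in the direction $v$ is, on exit, the same straight line as on entry. Directions are counted up to scaling and sign, so parallel vectors count as one direction. Non-flat means that the Riemann curvature tensor of $g$ does not vanish identically. *)

(* Defs.v *)
From mathcomp Require Import all_boot all_order all_algebra.
From mathcomp Require Import all_classical all_reals all_analysis.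

Set Implicit Arguments.
Unset Strict Implicit.
Unset Printing Implicit Defensive.

Import Order.TTheory GRing.Theory Num.Theory.
Import numFieldNormedType.Exports.

Local Open Scope classical_set_scope.
Local Open Scope ring_scope.

Section RiemannianMetrics.
Context {R : realType} {n : nat}.
Implicit Types (f : 'rV[R]_n -> R) (g : 'rV[R]_n -> 'M[R]_n).
Implicit Types (x p u v : 'rV[R]_n) (c : R -> 'rV[R]_n) (K : set 'rV[R]_n).

Definition partial (i : 'I_n) f : 'rV[R]_n -> R :=
  fun x => 'D_(delta_mx 0 i) f x.

Definition iter_partial (s : seq 'I_n) f : 'rV[R]_n -> R := foldr partial f s.

(* C^oo: the iterated partial derivatives of all orders exist and are
   continuous. *)
Definition smooth f : Prop :=
  forall s : seq 'I_n,
    continuous (iter_partial s f) /\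
    forall (i : 'I_n) x, derivable (iter_partial s f) x (delta_mx 0 i).

(* g x is the Gram matrix of the metric at x in the standard coordinates. *)
Definition riemannian_metric g : Prop :=
  [/\ forall i j : 'I_n, smooth (fun x => g x i j),
      forall x, (g x)^T = g x
    & forall x v, v != 0 -> 0 < (v *m g x *m v^T) 0 0].

Definition euclidean_outside K g : Prop := forall x, ~ K x -> g x = 1%:M.

(* Gamma^k_ij *)
Definition christoffel g (k i j : 'I_n) x : R :=
  2^-1 * \sum_(l < n) invmx (g x) k l *
    (partial i (fun y => g y j l) x + partial j (fun y => g y i l) x
     - partial l (fun y => g y i j) x).

(* R^l_kij, the coefficient of d_l in R(d_i, d_j) d_k. *)
Definition riemann_curvature g (l k i j : 'I_n) x : R :=
  partial i (christoffel g l j k) x - partial j (christoffel g l i k) x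
  + \sum_(m < n) (christoffel g l i m x * christoffel g m j k x
                  - christoffel g l j m x * christoffel g m i k x).

Definition flat g : Prop :=
  forall (l k i j : 'I_n) x, riemann_curvature g l k i j x = 0.

Definition coordinate c (k : 'I_n) : R -> R := fun t => c t 0 k.

(* Complete, affinely parametrized geodesics. A metric that is Euclidean
   outside a compact set is complete, so every maximal geodesic has this
   form. *)
Definition geodesic g c : Prop :=
  forall (k : 'I_n) (t : R),
    [/\ derivable (coordinate c k) t 1,
        derivable (derive1 (coordinate c k)) t 1
      & derive1 (derive1 (coordinate c k)) t
        + \sum_(i < n) \sum_(j < n) christoffel g k i j (c t) *
            derive1 (coordinate c i) t * derive1 (coordinate c j) t = 0].

(* Only the lines are compared, not their parametrizations: the delay d is
   arbitrary. *)
Definition invisible_direction g K v : Prop :=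
  v != 0 /\
  forall c p (t0 : R),
    geodesic g c ->
    (forall t, t <= t0 -> c t = p + t *: v) ->
    (exists t, K (c t)) ->
    exists t1 d : R, forall t, t1 <= t -> c t = p + (t + d) *: v.

Definition parallel u v : Prop := exists2 a : R, a != 0 & v = a *: u.

End RiemannianMetrics.

(* Main.v *)
Require Import Defs.
From mathcomp Require Import all_boot all_order all_algebra.
From mathcomp Require Import all_classical all_reals all_analysis.
From mathcomp Require Import ring lra.

Set Implicit Arguments.
Unset Strict Implicit.
Unset Printing Implicit Defensive.

Import Order.TTheory GRing.Theory Num.Theory.
Import numFieldNormedType.Exports.

Local Open Scope classical_set_scope.
Local Open Scope ring_scope.

(** Invisibility is obtained from a phase function. Suppose that S solves the
    eikonal equation g^-1 (dS, dS) = const and that S is the linear function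
    <v, .> outside K. The integral curves of the gradient field X = dS g^-1 are
    geodesics ([geodesic_gradient_field]), so by uniqueness a geodesic that
    comes in along a line of direction v stays tangent to X
    ([geodesic_follows_gradient]). It therefore leaves K in the direction v
    again, and only a sideways shift of the line remains to be excluded.

    In dimension at least three the shift can be excluded trivially. Take
    g = 1 + a E_kk with a bump function a. For v orthogonal to e_k the linear
    function <v, .> solves the eikonal equation everywhere and its gradient is
    the constant v, so all lines of direction v are geodesics
    ([straight_direction]). The directions orthogonal to e_k form a space of
    dimension at least two, which contains as many directions as desired.

    In the plane this gives one direction, while three are needed, and the shift
    is excluded by symmetry. If the reflection in the line orthogonal to v
    reverses the gradient field X, then an integral curve of X that crosses the
    mirror is its own mirror image, run backwards; so its outgoing line is the
    image of its incoming line, and this is the same line ([mirror_direction]).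
    The three directions are those of the root system A_2, at 120 degrees to
    each other. The squares of the three covectors form a basis of the quadratic
    forms in two variables, so that the three eikonal equations are a regular
    linear system for g^-1, and the three phase functions can be prescribed at
    will, as long as they are permuted up to sign by the reflections. Here the
    phase of the first direction is x + eps x^3 b, where b is a bump at (0, 2), a
    point of its mirror, and the other two are its rotations. Since the three
    rotated bumps are disjoint, at most one phase is nonlinear at each point, and
    g is diagonal there in the axes of this phase ([dented_metricE]); each phase
    satisfies its eikonal equation on all three bumps ([phase_eikonal]).

    Both metrics have the form 1 + (x_i)^2 Q near a point with x_i = 0, where the
    curvature component R^i_jij equals - Q_jj ([riemann_curvature_ridge]). It is a
    nonzero multiple of the amplitude of the deformation. So the metrics are not
    flat, and the same number tells the members of the family apart.

    All functions that occur are built from coordinates by field operations and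
    the flat function exp (- 1 / t); this class is closed under partial
    derivatives, which gives smoothness, and makes the chain rule along curves
    and the symmetry of second derivatives provable by induction. *)

(** * Derivation rules on the line *)

Section RealCalculus.
Context {R : realType}.
Implicit Types (f g : R -> R) (t a b : R).

(** These rules are stated for pointwise lambda expressions, with products in R
    in place of scalings, so that they compose by unification alone. *)
Lemma der1_eq f t a b : is_derive t 1 f a -> a = b -> is_derive t 1 f b.
Proof. by move=> ? <-. Qed.

Lemma der1_cst a t : is_derive t 1 (fun _ : R => a) (0 : R).
Proof. exact: (is_derive_cst a t 1). Qed.

Lemma der1_id t : is_derive t 1 (fun u : R => u) (1 : R).
Proof. exact: (is_derive_id t 1). Qed.

Lemma der1_add f g t a b : is_derive t 1 f a -> is_derive t 1 g b ->
  is_derive t 1 (fun u => f u + g u) (a + b).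
Proof. exact: is_deriveD. Qed.

Lemma der1_opp f t a : is_derive t 1 f a -> is_derive t 1 (fun u => - f u) (- a).
Proof. exact: is_deriveN. Qed.

Lemma der1_sub f g t a b : is_derive t 1 f a -> is_derive t 1 g b ->
  is_derive t 1 (fun u => f u - g u) (a - b).
Proof. exact: is_deriveB. Qed.

Lemma der1_mul f g t a b : is_derive t 1 f a -> is_derive t 1 g b ->
  is_derive t 1 (fun u => f u * g u) (a * g t + f t * b).
Proof.
move=> fa gb; apply: (der1_eq (@is_deriveM _ _ f g t 1 _ _ fa gb)).
by rewrite /GRing.scale/= addrC [g t * a]mulrC.
Qed.

Lemma der1_inv f t a : f t != 0 -> is_derive t 1 f a ->
  is_derive t 1 (fun u => (f u)^-1) (- (a * ((f t)^-1 * (f t)^-1))).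
Proof.
move=> f0 fa; apply: (der1_eq (is_deriveV f0 fa)).
by rewrite /GRing.scale/= expr2 invfM mulNr mulrC.
Qed.

Lemma der1_comp f g t a b : is_derive (g t) 1 f a -> is_derive t 1 g b ->
  is_derive t 1 (fun u => f (g u)) (b * a).
Proof. by move=> fa gb; rewrite mulrC; exact: (is_derive1_comp fa gb). Qed.

Lemma der1_sum n (f : 'I_n -> R -> R) t (a : 'I_n -> R) :
  (forall i, is_derive t 1 (f i) (a i)) ->
  is_derive t 1 (fun u => \sum_(i < n) f i u) (\sum_(i < n) a i).
Proof.
move=> fa; have := is_derive_sum fa.
by congr (is_derive _ _ _ _); apply/funext => u; rewrite fct_sumE.
Qed.

Lemma der1_continuous f t a : is_derive t 1 f a -> {for t, continuous f}.
Proof.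
by move=> [fd _]; apply: differentiable_continuous; exact/derivable1_diffP.
Qed.

Lemma der1_pow k t : is_derive t 1 (fun u : R => u ^+ k) (k%:R * t ^+ k.-1).
Proof.
elim: k => [|k IH]; first by rewrite mul0r; exact: der1_cst.
have -> : (fun u : R => u ^+ k.+1) = (fun u => u * u ^+ k).
  by apply/funext => u; rewrite exprS.
apply: (der1_eq (der1_mul (der1_id t) IH)).
case: k {IH} => [|k] /=; first by rewrite !expr0 mul0r mulr0 addr0.
by rewrite mulrCA -exprS -[k.+2]addn1 natrD mulrDl addrC !mul1r.
Qed.

Lemma der1_near f g t a : (\forall u \near t, f u = g u) ->
  is_derive t 1 f a -> is_derive t 1 g a.
Proof. exact: near_eq_is_derive. Qed.

End RealCalculus.

(** * The flat function *)

(** The family t^-k exp (- 1 / t), extended by zero, is closed under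
    derivation up to linear combinations; this is why the exponent k is kept. *)
Definition flat_exp {R : realType} (k : nat) (t : R) : R :=
  if 0 < t then t^-1 ^+ k * expR (- t^-1) else 0.

Section FlatExp.
Context {R : realType}.
Implicit Types (k : nat) (t : R).

Lemma flat_exp_npos k t : t <= 0 -> flat_exp k t = 0.
Proof. by rewrite /flat_exp ltNge => ->. Qed.

Lemma flat_exp_ge0 k t : 0 <= flat_exp k t.
Proof.
rewrite /flat_exp; case: ifP => // t0.
by rewrite mulr_ge0 ?expR_ge0// exprn_ge0// invr_ge0 ltW.
Qed.

(** With y = 1 / t this is the bound y^k exp (- y) <= k^k, the k-th power of
    y / k <= exp (y / k). *)
Lemma flat_exp_le k t : flat_exp k t <= k%:R ^+ k.
Proof.
rewrite /flat_exp; case: ifP => t0; last by rewrite exprn_ge0.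
case: k => [|k]; first by rewrite !expr0 mul1r expR_le1 oppr_le0 invr_ge0 ltW.
set y := t^-1; have y0 : 0 < y by rewrite invr_gt0.
rewrite expRN ler_pdivrMr ?expR_gt0//.
have -> : expR y = expR (y / k.+1%:R) ^+ k.+1.
  by rewrite -expRM_natl mulrC divfK// pnatr_eq0.
rewrite -exprMn; apply: lerXn2r; rewrite ?nnegrE ?(ltW y0)//.

rewrite -ler_pdivrMl ?ltr0n// mulrC.
by apply: le_trans (expR_ge1Dx _); rewrite lerDr.
Qed.

Lemma flat_expS k t : 0 < t -> flat_exp k t = t * flat_exp k.+1 t.
Proof.
by move=> t0; rewrite /flat_exp t0 exprS mulrA mulrA mulfV ?gt_eqF// mul1r.
Qed.

Lemma is_derive_flat_exp k t :
  is_derive t 1 (flat_exp k) (flat_exp k.+2 t - k%:R * flat_exp k.+1 t).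
Proof.
have [t0|t0|->] := ltgtP t 0.
- rewrite !flat_exp_npos ?(ltW t0)// mulr0 subr0.
  apply: (der1_near _ (der1_cst (0 : R) t)).
  by near=> u; rewrite flat_exp_npos//; near: u; exact: lt_le_nbhsl.
- have t1 : t != 0 by rewrite gt_eqF.
  have dV := der1_inv t1 (der1_id t).
  have dE := der1_mul (@der1_comp _ _ (fun u => u^-1) _ _ _ (der1_pow k t^-1) dV)
    (@der1_comp _ _ (fun u => - u^-1) _ _ _ (is_derive_expR (- t^-1)) (der1_opp dV)).
  apply: (der1_near _ (der1_eq dE _)).
    by near=> u; rewrite /flat_exp ifT//; near: u; exact: lt_nbhsr.
  by rewrite /flat_exp t0; case: k {dE} => [|k]; rewrite ?exprS ?expr0 /=; ring.
- rewrite !flat_exp_npos// mulr0 subr0.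
  suff H : h^-1 *: ((flat_exp k \o shift 0) (h *: (1 : R)) - flat_exp k 0)
           @[h --> (0:R)^'] --> (0 : R).
    by apply: DeriveDef; [exact/cvg_ex/(ex_intro _ 0)|exact: cvg_lim].
  (* The difference quotient at h > 0 is flat_exp k.+1 h, which is at most C h. *)
  pose C : R := k.+2%:R ^+ k.+2.
  have C0 : 0 < C by rewrite exprn_gt0.
  apply/cvgr0Pnorm_le => e e0; near=> h.
  have h0 : h != 0 by near: h; exact: nbhs_dnbhs_neq.
  rewrite /= /GRing.scale/= mulr1 addr0 [X in _ - X]flat_exp_npos// subr0.
  have [hn|hp] := lerP h 0; first by rewrite flat_exp_npos// mulr0 normr0 ltW.
  rewrite (flat_expS _ hp) mulKf// ger0_norm ?flat_exp_ge0//.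
  rewrite (flat_expS _ hp).
  apply: (@le_trans _ _ (h * C)); first by rewrite ler_wpM2l ?(ltW hp)// flat_exp_le.
  rewrite -ler_pdivlMr//; apply: le_trans (ler_norm _) _.
  near: h; apply: dnbhs0_le; exact: divr_gt0.
Unshelve. all: by end_near. Qed.

End FlatExp.

(** * Elementary functions *)

Section Elementary.
Context {R : realType} {n : nat}.
Implicit Types (f g : 'rV[R]_n -> R) (x v : 'rV[R]_n).

(** A class of smooth functions that is large enough for the metrics below and
    visibly closed under partial derivatives. *)
Inductive elementary : ('rV[R]_n -> R) -> Prop :=
| elementary_cst a : elementary (fun=> a)
| elementary_coord i : elementary (fun x => x 0 i)
| elementary_add f g : elementary f -> elementary g ->
    elementary (fun x => f x + g x)
| elementary_mul f g : elementary f -> elementary g ->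
    elementary (fun x => f x * g x)
| elementary_inv f : elementary f -> (forall x, f x != 0) ->
    elementary (fun x => (f x)^-1)
| elementary_flat k f : elementary f -> elementary (fun x => flat_exp k (f x)).

Lemma elementary_opp f : elementary f -> elementary (fun x => - f x).
Proof.
move=> ef; have := elementary_mul (elementary_cst (-1)) ef.
by congr elementary; apply/funext => x; rewrite mulN1r.
Qed.

Lemma elementary_sub f g : elementary f -> elementary g ->
  elementary (fun x => f x - g x).
Proof. by move=> ef eg; exact: elementary_add ef (elementary_opp eg). Qed.

Lemma elementary_sum (I : Type) (r : seq I) (P : pred I)
    (F : I -> 'rV[R]_n -> R) :
  (forall i, elementary (F i)) ->
  elementary (fun x => \sum_(i <- r | P i) F i x).
Proof.
move=> eF; rewrite -fct_sumE; elim/big_rec: _ => [|i f _ ef].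
  exact: elementary_cst.
exact: elementary_add.
Qed.

Lemma elementary_prod (I : Type) (r : seq I) (P : pred I)
    (F : I -> 'rV[R]_n -> R) :
  (forall i, elementary (F i)) ->
  elementary (fun x => \prod_(i <- r | P i) F i x).
Proof.
move=> eF; rewrite -fct_prodE; elim/big_rec: _ => [|i f _ ef].
  exact: elementary_cst.
exact: elementary_mul.
Qed.

Lemma elementary_pow f k : elementary f -> elementary (fun x => f x ^+ k).
Proof.
move=> ef; elim: k => [|k IH].
  by have := elementary_cst 1; congr elementary.
have := elementary_mul ef IH.
by congr elementary; apply/funext => x; rewrite exprS.
Qed.

Lemma elementary_continuous f : elementary f -> continuous f.
Proof.
elim=> [a|i|{}f g _ cf _ cg|{}f g _ cf _ cg|{}f _ cf f0|k {}f _ cf] x.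
- exact: cst_continuous.
- exact: coord_continuous.
- exact: cvgD (cf x) (cg x).
- exact: cvgM (cf x) (cg x).
- exact: cvgV (f0 x) (cf x).
- apply: (@continuous_comp _ _ _ f (flat_exp k) x (cf x)).
  exact: der1_continuous (is_derive_flat_exp k (f x)).
Qed.

(** The gradient is characterised by the chain rule along all curves: this
    property passes through the constructors of [elementary] by one-variable
    calculus, and contains the partial derivatives as the case of coordinate
    lines. *)
Definition has_gradient f (df : 'I_n -> 'rV[R]_n -> R) : Prop :=
  forall (c : R -> 'rV[R]_n) (t : R) (w : 'I_n -> R),
  (forall k, is_derive t 1 (coordinate c k) (w k)) ->
  is_derive t 1 (fun u => f (c u)) (\sum_(k < n) w k * df k (c t)).

Lemma is_derive_line f x v a :
  is_derive (0 : R) 1 (fun h => f (h *: v + x)) a -> is_derive x v f a.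
Proof.
move=> [fd <-]; have fx : derivable f x v by apply/derivable1P.
apply: (DeriveDef fx).
suff E : (fun h : R => h^-1 *: ((f \o shift x) (h *: v) - f x)) =
    (fun h => h^-1 *: (((fun h => f (h *: v + x)) \o shift 0) (h *: (1 : R))
                       - f (0 *: v + x))) by rewrite /derive E.
apply/funext => h /=.
by rewrite scale0r add0r addr0 [h *: (1 : R)]mulr1.
Qed.

Lemma has_gradient_partial f df : has_gradient f df ->
  forall i x, is_derive x (delta_mx 0 i) f (df i x).
Proof.
move=> fdf i x; apply: is_derive_line.
have := fdf (fun h => h *: delta_mx 0 i + x) 0 (fun k => (i == k)%:R).
rewrite scale0r add0r (bigD1 i)//= eqxx mul1r big1 ?addr0; last first.
  by move=> k ki; rewrite eq_sym (negbTE ki) mul0r.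
apply => k.
have -> : coordinate (fun h => h *: delta_mx 0 i + x) k =
          (fun h => h * (i == k)%:R + x 0 k).
  by apply/funext => h; rewrite /coordinate !mxE eqxx/= [k == i]eq_sym.
apply: (der1_eq (der1_add (der1_mul (der1_id 0) (der1_cst (i == k)%:R 0))
  (der1_cst (x 0 k) 0))).
by rewrite mul1r mulr0 !addr0.
Qed.

Lemma has_gradient_cst a : has_gradient (fun=> a) (fun _ _ => 0).
Proof.
by move=> c t w _; rewrite big1 => [|k _]; [exact: der1_cst|rewrite mulr0].
Qed.

Lemma has_gradient_coord i : has_gradient (fun x => x 0 i) (fun k _ => (k == i)%:R).
Proof.
move=> c t w cw; rewrite (bigD1 i)//= eqxx mulr1 big1 ?addr0; first exact: cw.
by move=> k /negbTE ->; rewrite mulr0.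
Qed.

Lemma has_gradient_add f g df dg : has_gradient f df -> has_gradient g dg ->
  has_gradient (fun x => f x + g x) (fun k x => df k x + dg k x).
Proof.
move=> fdf gdg c t w cw; apply: (der1_eq (der1_add (fdf c t w cw) (gdg c t w cw))).
by rewrite -big_split; apply: eq_bigr => k _; rewrite mulrDr.
Qed.

Lemma has_gradient_mul f g df dg : has_gradient f df -> has_gradient g dg ->
  has_gradient (fun x => f x * g x) (fun k x => df k x * g x + f x * dg k x).
Proof.
move=> fdf gdg c t w cw; apply: (der1_eq (der1_mul (fdf c t w cw) (gdg c t w cw))).
by rewrite mulr_suml mulr_sumr -big_split; apply: eq_bigr => k _ /=; ring.
Qed.

Lemma has_gradient_inv f df : (forall x, f x != 0) -> has_gradient f df ->
  has_gradient (fun x => (f x)^-1) (fun k x => - (df k x * ((f x)^-1 * (f x)^-1))).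
Proof.
move=> f0 fdf c t w cw.
apply: (der1_eq (@der1_inv _ (fun u => f (c u)) _ _ (f0 _) (fdf c t w cw))).
by rewrite mulr_suml -sumrN; apply: eq_bigr => k _; ring.
Qed.

Lemma has_gradient_flat m f df : has_gradient f df ->
  has_gradient (fun x => flat_exp m (f x))
   (fun k x => df k x * (flat_exp m.+2 (f x) - m%:R * flat_exp m.+1 (f x))).
Proof.
move=> fdf c t w cw; apply: (der1_eq (@der1_comp _ _ (fun u => f (c u)) _ _ _
  (is_derive_flat_exp m _) (fdf c t w cw))).
by rewrite mulr_suml; apply: eq_bigr => i _; rewrite mulrA.
Qed.

Lemma elementary_gradient f : elementary f ->
  exists2 df, forall i, elementary (df i) & has_gradient f df.
Proof.
elim=> [a|i|{}f g ef [df edf fdf] eg [dg edg gdg]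
           |{}f g ef [df edf fdf] eg [dg edg gdg]
           |{}f ef [df edf fdf] f0|k {}f ef [df edf fdf]].
- eexists; last exact: has_gradient_cst.
  by move=> k; exact: elementary_cst.
- eexists; last exact: has_gradient_coord.
  by move=> k; exact: elementary_cst.
- eexists; last exact: has_gradient_add fdf gdg.
  by move=> k; exact: elementary_add.
- eexists; last exact: has_gradient_mul fdf gdg.
  by move=> k; apply: elementary_add; apply: elementary_mul.
- eexists; last exact: has_gradient_inv f0 fdf.
  by move=> k; apply/elementary_opp/elementary_mul => //;
    apply: elementary_mul; apply: elementary_inv.
- eexists; last exact: has_gradient_flat fdf.
  move=> i; apply: elementary_mul => //; apply: elementary_sub.
    exact: elementary_flat.
  by apply: elementary_mul; [exact: elementary_cst|exact: elementary_flat].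
Qed.

Lemma has_gradientE f df : has_gradient f df -> df = partial^~ f.
Proof.
move=> fdf; apply/funext => i; apply/funext => x.
by have [_ <-] := has_gradient_partial fdf i x.
Qed.

Lemma elementary_partial f i : elementary f -> elementary (partial i f).
Proof.
by move=> /elementary_gradient[df edf /has_gradientE E]; move: (edf i); rewrite E.
Qed.

Lemma elementary_has_gradient f : elementary f -> has_gradient f (partial^~ f).
Proof.
by move=> /elementary_gradient[df edf fdf]; rewrite -(has_gradientE fdf).
Qed.

Lemma elementary_is_derive f i x : elementary f ->
  is_derive x (delta_mx 0 i) f (partial i f x).
Proof. by move=> /elementary_has_gradient/has_gradient_partial. Qed.

Lemma elementary_smooth f : elementary f -> smooth f.
Proof.
move=> ef s; have es : elementary (iter_partial s f).
  by elim: s => //= i s IH; exact: elementary_partial.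
split=> [|i x]; first exact: elementary_continuous.
by have [] := elementary_is_derive i x es.
Qed.

Lemma partial_cst i a : partial i (fun=> a) = (fun=> 0) :> ('rV[R]_n -> R).
Proof. by move: (has_gradientE (has_gradient_cst a)) => /(congr1 (@^~ i)) <-. Qed.

Lemma partial_coord i j :
  partial i (fun x => x 0 j) = (fun=> (i == j)%:R) :> ('rV[R]_n -> R).
Proof. by move: (has_gradientE (has_gradient_coord j)) => /(congr1 (@^~ i)) <-. Qed.

Lemma partial_add i f g : elementary f -> elementary g ->
  partial i (fun x => f x + g x) = (fun x => partial i f x + partial i g x).
Proof.
move=> /elementary_has_gradient hf /elementary_has_gradient hg.
by move: (has_gradientE (has_gradient_add hf hg)) => /(congr1 (@^~ i)) <-.
Qed.

Lemma partial_mul i f g : elementary f -> elementary g ->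
  partial i (fun x => f x * g x) =
  (fun x => partial i f x * g x + f x * partial i g x).
Proof.
move=> /elementary_has_gradient hf /elementary_has_gradient hg.
by move: (has_gradientE (has_gradient_mul hf hg)) => /(congr1 (@^~ i)) <-.
Qed.

Lemma partial_inv i f : elementary f -> (forall x, f x != 0) ->
  partial i (fun x => (f x)^-1) =
  (fun x => - (partial i f x * ((f x)^-1 * (f x)^-1))).
Proof.
move=> /elementary_has_gradient hf f0.
by move: (has_gradientE (has_gradient_inv f0 hf)) => /(congr1 (@^~ i)) <-.
Qed.

Lemma partial_flat i m f : elementary f ->
  partial i (fun x => flat_exp m (f x)) =
  (fun x => partial i f x * (flat_exp m.+2 (f x) - m%:R * flat_exp m.+1 (f x))).
Proof.
move=> /elementary_has_gradient hf.
by move: (has_gradientE (has_gradient_flat m hf)) => /(congr1 (@^~ i)) <-.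
Qed.

Lemma partial_sum (I : Type) (r : seq I) i (F : I -> 'rV[R]_n -> R) :
  (forall k, elementary (F k)) ->
  partial i (fun x => \sum_(k <- r) F k x) =
  (fun x => \sum_(k <- r) partial i (F k) x).
Proof.
move=> eF; elim: r => [|k r IH].
  under eq_fun do rewrite big_nil.
  by rewrite partial_cst; apply/funext => x; rewrite big_nil.
under eq_fun do rewrite big_cons.
rewrite partial_add//; last exact: elementary_sum.
by rewrite IH; apply/funext => x; rewrite big_cons.
Qed.

Lemma partial_mulE i f g x : elementary f -> elementary g ->
  partial i (fun x => f x * g x) x = partial i f x * g x + f x * partial i g x.
Proof. by move=> ef eg; rewrite (partial_mul i ef eg). Qed.

(** Symmetry of second derivatives needs no analysis here: both sides obey the
    same product and chain rules. *)
Lemma partial_comm i j f : elementary f ->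
  partial i (partial j f) = partial j (partial i f).
Proof.
elim=> [a|k|{}f g ef IHf eg IHg|{}f g ef IHf eg IHg|{}f ef IHf f0|k {}f ef IHf].
- by rewrite !partial_cst.
- by rewrite !partial_coord !partial_cst.
- have pf k := elementary_partial k ef; have pg k := elementary_partial k eg.
  rewrite (partial_add i ef eg) (partial_add j ef eg).
  by rewrite (partial_add i (pf j) (pg j)) (partial_add j (pf i) (pg i)) IHf IHg.
- have pf k := elementary_partial k ef; have pg k := elementary_partial k eg.
  rewrite (partial_mul i ef eg) (partial_mul j ef eg).
  rewrite (partial_add i (elementary_mul (pf j) eg) (elementary_mul ef (pg j))).
  rewrite (partial_add j (elementary_mul (pf i) eg) (elementary_mul ef (pg i))).
  apply/funext => x.
  rewrite (partial_mulE i x (pf j) eg) (partial_mulE i x ef (pg j)).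
  rewrite (partial_mulE j x (pf i) eg) (partial_mulE j x ef (pg i)) IHf IHg.
  ring.
- have pf k := elementary_partial k ef.
  have ei := elementary_inv ef f0; have ei2 := elementary_mul ei ei.
  have pN k : partial k (fun x => (f x)^-1) =
      (fun x => -1 * (partial k f x * ((f x)^-1 * (f x)^-1))).
    by rewrite (partial_inv k ef f0); apply/funext => x; rewrite mulN1r.
  have c1 := elementary_cst (-1).
  rewrite (pN i) (pN j).
  have E m l x : partial m (fun x => -1 * (partial l f x * ((f x)^-1 * (f x)^-1))) x
     = - (partial m (partial l f) x * ((f x)^-1 * (f x)^-1)
          - 2 * partial l f x * partial m f x * (f x)^-1 ^+ 3).
    rewrite (partial_mulE m x c1 (elementary_mul (pf l) ei2)) partial_cst.
    rewrite (partial_mulE m x (pf l) ei2) (partial_mulE m x ei ei) (pN m).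
    ring.
  by apply/funext => x; rewrite !E IHf; ring.
- have pf l := elementary_partial l ef.
  pose h (x : 'rV[R]_n) := flat_exp k.+2 (f x) + (- k%:R) * flat_exp k.+1 (f x).
  have ek m := elementary_flat m ef; have ck := elementary_cst (- k%:R).
  have eh : elementary h := elementary_add (ek k.+2) (elementary_mul ck (ek k.+1)).
  have pF l : partial l (fun x => flat_exp k (f x)) = (fun x => partial l f x * h x).
    by rewrite (partial_flat l k ef); apply/funext => x; rewrite /h mulNr.
  rewrite (pF i) (pF j); apply/funext => x.
  rewrite (partial_mulE i x (pf j) eh) (partial_mulE j x (pf i) eh) IHf.
  rewrite /h (partial_add i (ek k.+2) (elementary_mul ck (ek k.+1))).
  rewrite (partial_add j (ek k.+2) (elementary_mul ck (ek k.+1))).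
  rewrite (partial_mulE i x ck (ek k.+1)) (partial_mulE j x ck (ek k.+1)).
  rewrite !partial_cst !(partial_flat _ _ ef); ring.
Qed.

End Elementary.

(** * Gradient fields of phase functions *)

Section MatrixFields.
Context {R : realType} {n : nat}.
Implicit Types (g : 'rV[R]_n -> 'M[R]_n).

Definition elementary_mx {p q : nat} (A : 'rV[R]_n -> 'M[R]_(p, q)) : Prop :=
  forall i j, elementary (fun x => A x i j).

Lemma elementary_mx_const m k (A : 'M[R]_(m, k)) :
  elementary_mx (fun _ : 'rV[R]_n => A).
Proof. by move=> i j; exact: elementary_cst. Qed.

Lemma elementary_mx_add m k (A B : 'rV[R]_n -> 'M[R]_(m, k)) :
  elementary_mx A -> elementary_mx B -> elementary_mx (fun x => A x + B x).
Proof.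
by move=> eA eB i j; under eq_fun do rewrite mxE; exact: elementary_add.
Qed.

Lemma elementary_det p (A : 'rV[R]_n -> 'M[R]_p) :
  elementary_mx A -> elementary (fun x => \det (A x)).
Proof.
move=> eA; rewrite /determinant; apply: elementary_sum => s.
apply: elementary_mul; first exact: elementary_cst.
exact: elementary_prod.
Qed.

Lemma elementary_invmx g : elementary_mx g -> (forall x, g x \in unitmx) ->
  elementary_mx (fun x => invmx (g x)).
Proof.
move=> eg ug i j.
have -> : (fun x => invmx (g x) i j) =
    (fun x => (\det (g x))^-1 * cofactor (g x) j i).
  by apply/funext => x; rewrite /invmx ug !mxE.
apply: elementary_mul.
  apply: elementary_inv => [|x]; first exact: elementary_det.
  by have := ug x; rewrite unitmxE unitfE.
rewrite /cofactor; apply: elementary_mul; first exact: elementary_cst.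
apply: elementary_det => k l.
have -> : (fun x => row' j (col' i (g x)) k l) =
   (fun x => g x (lift j k) (lift i l)) by apply/funext => x; rewrite !mxE.
exact: eg.
Qed.

Lemma elementary_mulmx p q r (A : 'rV[R]_n -> 'M[R]_(p, q))
    (B : 'rV[R]_n -> 'M[R]_(q, r)) :
  elementary_mx A -> elementary_mx B -> elementary_mx (fun x => A x *m B x).
Proof.
move=> eA eB i j; under eq_fun do rewrite mxE.
by apply: elementary_sum => k; apply: elementary_mul.
Qed.

Lemma elementary_christoffel g k i j : elementary_mx g ->
  (forall x, g x \in unitmx) -> elementary (christoffel g k i j).
Proof.
move=> eg ug; apply: elementary_mul; first exact: elementary_cst.
apply: elementary_sum => l; apply: elementary_mul; first exact: elementary_invmx.
by apply: elementary_sub; [apply: elementary_add|]; apply: elementary_partial.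
Qed.

Definition gradient_field g (S : 'rV[R]_n -> R) (x : 'rV[R]_n) : 'rV[R]_n :=
  (\row_k partial k S x) *m invmx (g x).

(** The way in which all gradient fields below are computed: guess the field and
    check it against the metric, without inverting a matrix. *)
Lemma gradient_fieldP (g : 'rV[R]_n -> 'M[R]_n) (S : 'rV[R]_n -> R) x Y :
  g x \in unitmx -> Y *m g x = \row_k partial k S x -> gradient_field g S x = Y.
Proof. by move=> ug E; rewrite /gradient_field -E mulmxK. Qed.

Lemma gradient_field_mul (g : 'rV[R]_n -> 'M[R]_n) (S : 'rV[R]_n -> R) x :
  g x \in unitmx -> gradient_field g S x *m g x = \row_k partial k S x.
Proof. by move=> ug; rewrite /gradient_field mulmxKV. Qed.

Lemma row_dot (S : 'rV[R]_n -> R) (V : 'rV[R]_n) x :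
  \sum_k partial k S x * V 0 k = ((\row_k partial k S x) *m V^T) 0 0.
Proof. by rewrite mxE; apply: eq_bigr => k _; rewrite !mxE. Qed.

Lemma elementary_gradient_field g S : elementary_mx g ->
  (forall x, g x \in unitmx) -> elementary S ->
  elementary_mx (gradient_field g S).
Proof.
move=> eg ug eS; apply: elementary_mulmx; last exact: elementary_invmx.
move=> i j; under eq_fun do rewrite mxE.
exact: elementary_partial.
Qed.

Lemma mul_mx_christoffel g m i j x : g x \in unitmx ->
  \sum_(k < n) g x m k * christoffel g k i j x =
  2^-1 * (partial i (fun y => g y j m) x + partial j (fun y => g y i m) x
     - partial m (fun y => g y i j) x).
Proof.
move=> ug; set T := fun l => partial i (fun y => g y j l) x
  + partial j (fun y => g y i l) x - partial l (fun y => g y i j) x.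
transitivity (2^-1 * \sum_l (g x *m invmx (g x)) m l * T l).
  rewrite mulr_sumr.
  under eq_bigr do rewrite /christoffel mulrCA mulr_sumr mulr_sumr.
  rewrite exchange_big; apply: eq_bigr => l _.
  rewrite mxE mulr_suml mulr_sumr; apply: eq_bigr => k _; rewrite -/(T l); ring.
rewrite mulmxV// (bigD1 m)//= mxE eqxx mul1r big1 ?addr0// => l lm.
by rewrite mxE eq_sym (negbTE lm) mul0r.
Qed.

(** The integral curves of the gradient field of a solution of the eikonal
    equation are geodesics. With dS = X g, derive in the direction m both the
    eikonal equation dS . X = kappa and the identity dS = X g; this gives
    2 (D^2 S) (X, e_m) = (d_m g) (X, X), and since D^2 S is symmetric this is the
    lowered geodesic equation. *)
Lemma geodesic_gradient_field g S kappa :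
  elementary_mx g -> (forall x, (g x)^T = g x) -> (forall x, g x \in unitmx) ->
  elementary S ->
  (forall x, \sum_k partial k S x * gradient_field g S x 0 k = kappa) ->
  forall k x, let X := gradient_field g S in
  \sum_(i < n) \sum_(j < n) christoffel g k i j x * X x 0 i * X x 0 j
  + \sum_(j < n) X x 0 j * partial j (fun y => X y 0 k) x = 0.
Proof.
move=> eg sg ug eS eik k x X.
have eX : elementary_mx X := elementary_gradient_field eg ug eS.
have gC y i j : g y i j = g y j i by rewrite -[in LHS]sg mxE.
have dS m : partial m S = fun y => \sum_k X y 0 k * g y k m.
  apply/funext => y; transitivity ((X y *m g y) 0 m); last by rewrite mxE.
  by rewrite /X /gradient_field mulmxKV// mxE.
have ddS j m y : partial j (partial m S) y =
    \sum_k partial j (fun z => X z 0 k) y * g y k m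
  + \sum_k X y 0 k * partial j (fun z => g z k m) y.
  rewrite dS partial_sum => [|l]; last by apply: elementary_mul.
  by rewrite -big_split; apply: eq_bigr => l _; rewrite partial_mul.
(* W m is (d_m g) (X, X). *)
pose W m := \sum_i \sum_j partial m (fun z => g z i j) x * X x 0 i * X x 0 j.
have eikm m : 2 * (\sum_j X x 0 j * partial m (partial j S) x) = W m.
  (* The derivative of the eikonal equation. *)
  have U1 : \sum_j X x 0 j * partial m (partial j S) x
      = - \sum_j partial m (fun z => X z 0 j) x * partial j S x.
    apply/eqP; rewrite -addr_eq0 -big_split/=.
    have eSX l : elementary (fun y => partial l S y * X y 0 l).
      by apply: elementary_mul; [exact: elementary_partial|exact: eX].
    have : partial m (fun y => \sum_k partial k S y * X y 0 k) x = 0.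
      by rewrite (funext eik) partial_cst.
    rewrite partial_sum// => d0; apply/eqP; rewrite -[RHS]d0.
    apply: eq_bigr => j _.
    by rewrite partial_mul//; [ring|exact: elementary_partial].
  (* The derivative of dS = X g, contracted with X. *)
  have U2 : \sum_j X x 0 j * partial m (partial j S) x
      = \sum_j partial m (fun z => X z 0 j) x * partial j S x + W m.
    rewrite /W; under eq_bigr do rewrite ddS mulrDr.
    rewrite big_split/=; congr +%R.
      under eq_bigr do rewrite mulr_sumr.
      rewrite exchange_big; apply: eq_bigr => i _ /=.
      rewrite dS mulr_sumr; apply: eq_bigr => j _; rewrite (gC x j i); ring.
    under eq_bigr do rewrite mulr_sumr.
    rewrite exchange_big; apply: eq_bigr => i _ /=.
    apply: eq_bigr => j _; ring.
  by rewrite mulr_natl mulr2n {1}U1 U2 addrA addNr add0r.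
set Z := fun k => \sum_(i < n) \sum_(j < n) christoffel g k i j x * X x 0 i * X x 0 j
  + \sum_(j < n) X x 0 j * partial j (fun y => X y 0 k) x.
suff gZ : g x *m (\col_k Z k) = 0.
  have := congr1 (mulmx (invmx (g x))) gZ; rewrite mulmx0 mulKmx//.
  by move=> /matrixP/(_ k 0); rewrite !mxE.
apply/matrixP => m o; rewrite !mxE.
under eq_bigr do rewrite mxE /Z mulrDr.
rewrite big_split/=.
pose V := \sum_i \sum_j X x 0 i * X x 0 j * partial i (fun z => g z j m) x.
have -> : \sum_l g x m l * (\sum_(i < n) \sum_(j < n)
     christoffel g l i j x * X x 0 i * X x 0 j) = V - 2^-1 * W m.
  transitivity (\sum_i \sum_j X x 0 i * X x 0 j *
     (\sum_l g x m l * christoffel g l i j x)).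
    under eq_bigr do rewrite mulr_sumr.
    rewrite exchange_big/=; apply: eq_bigr => i _.
    under eq_bigr do rewrite mulr_sumr.
    rewrite exchange_big/=; apply: eq_bigr => j _.
    by rewrite mulr_sumr; apply: eq_bigr => l _; ring.
  have V2 : V = 2^-1 * V + 2^-1 * \sum_i \sum_j X x 0 i * X x 0 j *
       partial j (fun z => g z i m) x.
    suff <- : V = \sum_i \sum_j X x 0 i * X x 0 j * partial j (fun z => g z i m) x.
      by field.
    rewrite /V exchange_big/=; apply: eq_bigr => i _; apply: eq_bigr => j _.
    by rewrite [X x 0 j * _]mulrC.
  rewrite V2 /W !mulr_sumr -!big_split -sumrB/=; apply: eq_bigr => i _.
  rewrite !mulr_sumr -!big_split -sumrB/=; apply: eq_bigr => j _.
  by rewrite mul_mx_christoffel//; ring.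
have -> : \sum_l g x m l * (\sum_j X x 0 j * partial j (fun y => X y 0 l) x)
    = 2^-1 * W m - V.
  rewrite -eikm mulKf//.
  under [X in _ = X - _]eq_bigr do rewrite (partial_comm m _ eS) ddS mulrDr.
  rewrite big_split/=; rewrite [X in _ = _ + X - _](_ : _ = V) ?addrK; last first.
    apply: eq_bigr => j _; rewrite mulr_sumr.
    by apply: eq_bigr => l _; rewrite mulrA.
  under eq_bigr do rewrite mulr_sumr.
  rewrite exchange_big/=; apply: eq_bigr => j _; rewrite mulr_sumr.
  by apply: eq_bigr => l _; rewrite (gC x m l); ring.
by rewrite addrA subrK subrr.
Qed.
End MatrixFields.

(** * Uniqueness of integral curves *)

Section Gronwall.
Context {R : realType}.

Lemma gronwall (phi dphi : R -> R) (C a b : R) :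
  (forall t : R, is_derive t 1 phi (dphi t)) -> (forall t, 0 <= phi t) ->
  phi a = 0 -> a <= b ->
  (forall t, a <= t <= b -> dphi t <= C * phi t) -> phi b = 0.
Proof.
move=> dp p0 pa ab H.
(* psi is nonincreasing on [a, b]. *)
pose psi t := phi t * expR (- (C * t)).
have dpsi (t : R) : is_derive t 1 psi ((dphi t - C * phi t) * expR (- (C * t))).
  have dl := der1_opp (der1_mul (der1_cst C t) (der1_id t)).
  apply: (der1_eq (der1_mul (dp t) (@der1_comp _ _ (fun t => - (C * t)) _ _ _
    (is_derive_expR _) dl))).
  ring.
have cpsi : {within `[a, b], continuous psi}.
  by apply: continuous_subspaceT => t; exact: der1_continuous (dpsi t).
have [s] := MVT_segment ab (fun t _ => dpsi t) cpsi.
rewrite in_itv/= => /H hs psiE.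
have : psi b <= psi a.
  rewrite -subr_le0 psiE; apply: mulr_le0_ge0; last by rewrite subr_ge0.
  by apply: mulr_le0_ge0; rewrite ?expR_ge0// subr_le0.
rewrite /psi pa mul0r pmulr_lle0 ?expR_gt0// => pb.
by apply/eqP; rewrite eq_le pb p0.
Qed.

Lemma sqr_sum_norm n (d : 'I_n -> R) :
  (\sum_i `|d i|) ^+ 2 <= n%:R * \sum_i d i ^+ 2.
Proof.
have -> : n%:R * \sum_i d i ^+ 2 =
    \sum_i \sum_j 2^-1 * (d i ^+ 2 + d j ^+ 2).
  set Q := \sum_i d i ^+ 2.
  transitivity (\sum_i 2^-1 * (n%:R * d i ^+ 2 + Q)).
    rewrite -mulr_sumr big_split/= -mulr_sumr sumr_const card_ord -/Q.
    by rewrite -[Q *+ n]mulr_natl; field.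
  apply: eq_bigr => i _.
  by rewrite -mulr_sumr big_split/= sumr_const card_ord -[d i ^+ 2 *+ n]mulr_natl.
rewrite expr2 mulr_suml; apply: ler_sum => i _; rewrite mulr_sumr.
apply: ler_sum => j _; rewrite -[d i ^+ 2]real_normK ?num_real//.
rewrite -[d j ^+ 2]real_normK ?num_real//.
have := sqr_ge0 (`|d i| - `|d j|); rewrite sqrrB; lra.
Qed.

(** Apply [gronwall] to the sum of the squares of the d k. *)
Lemma ode_zero n (d d' : 'I_n -> R -> R) (a : R) :
  (forall k (t : R), is_derive t 1 (d k) (d' k t)) -> (forall k, d k a = 0) ->
  (forall b, exists C, forall t, a <= t <= b ->
     forall k, `|d' k t| <= C * \sum_j `|d j t|) ->
  forall t, a <= t -> forall k, d k t = 0.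
Proof.
move=> dd da bd b ab.
have [C HC] := bd b.
pose phi t := \sum_k d k t ^+ 2.
have phi0 t : 0 <= phi t by apply: sumr_ge0 => k _; exact: sqr_ge0.
suff pb : phi b = 0.
  move=> k; apply/eqP; rewrite -sqrf_eq0; apply/eqP.
  have /psumr_eq0P : forall i : 'I_n, true -> 0 <= d i b ^+ 2.
    by move=> i _; exact: sqr_ge0.
  by apply.
have dphi (t : R) : is_derive t 1 phi (\sum_k (d' k t * d k t + d k t * d' k t)).
  have -> : phi = (fun t => \sum_k d k t * d k t).
    by apply/funext => u; apply: eq_bigr => k _; rewrite expr2.
  by apply: der1_sum => k; exact: der1_mul.
apply: (gronwall (C := 2 * `|C| * n%:R) dphi phi0 _ ab).
  by apply: big1 => k _; rewrite da expr0n.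
move=> t /HC {}HC.
apply: (@le_trans _ _ (2 * `|C| * (\sum_i `|d i t|) ^+ 2)); last first.
  by rewrite -[leRHS]mulrA ler_wpM2l ?mulr_ge0// sqr_sum_norm.
rewrite expr2 mulrA [leRHS]mulr_sumr; apply: ler_sum => k _.
have -> : d' k t * d k t + d k t * d' k t = 2 * (d' k t * d k t) by ring.
rewrite -!mulrA ler_wpM2l//; apply: le_trans (ler_norm _) _.
rewrite normrM mulrA ler_wpM2r//; apply: le_trans (HC k) _.
by rewrite ler_wpM2r ?sumr_ge0// ler_norm.
Qed.

Lemma continuous_itv_bound (f : R -> R) (a b : R) : continuous f ->
  exists M, 0 <= M /\ forall t, a <= t <= b -> `|f t| <= M.
Proof.
move=> cf; have [ab|ba] := leP a b; last first.
  by exists 0; split=> // t /andP[at_ tb]; have := le_trans at_ tb; rewrite leNgt ba.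
have cnf : {within `[a, b], continuous (fun t => `|f t|)}.
  by apply: continuous_subspaceT => t; exact: cvg_norm (cf t).
have [c _ Hc] := EVT_max ab cnf.
by exists `|f c|; split=> // t tab; apply: Hc; rewrite in_itv.
Qed.

Lemma linear_ode_zero n (d : 'I_n -> R -> R) (A : 'I_n -> 'I_n -> R -> R) (a : R) :
  (forall k (t : R), is_derive t 1 (d k) (- \sum_j A k j t * d j t)) ->
  (forall k j, continuous (A k j)) -> (forall k, d k a = 0) ->
  forall t, a <= t -> forall k, d k t = 0.
Proof.
move=> dd cA da; apply: (ode_zero dd da) => b.
have /choice[M HM] : forall kj : 'I_n * 'I_n, exists M, 0 <= M /\
    forall t, a <= t <= b -> `|A kj.1 kj.2 t| <= M.
  by move=> kj; exact: continuous_itv_bound.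
exists (\sum_kj M kj) => t tab k; rewrite normrN.
apply: le_trans (ler_norm_sum _ _ _) _; rewrite mulr_sumr; apply: ler_sum => j _.
rewrite normrM ler_wpM2r//; apply: le_trans ((HM (k, j)).2 t tab) _.
by rewrite (bigD1 (k, j))//= lerDl sumr_ge0// => kj _; have [] := HM kj.
Qed.

End Gronwall.

Section Lipschitz.
Context {R : realType} {n : nat}.
Implicit Types (f : 'rV[R]_n -> R) (x y : 'rV[R]_n) (r : R).

Definition box r : set 'rV[R]_n := [set x | forall i, `|x 0 i| <= r].

Lemma box_compact r : compact (box r).
Proof.
have -> : box r = [set x : 'rV[R]_n | forall i, `[-r, r]%classic (x ord0 i)].
  by apply/seteqP; split=> x /= H i; move: (H i); rewrite in_itv/= ler_norml.
by apply: (rV_compact (A := fun=> `[-r, r]%classic)) => i; exact: segment_compact.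
Qed.

Lemma elementary_box_bound f r : elementary f ->
  exists M, 0 <= M /\ forall x, box r x -> `|f x| <= M.
Proof.
move=> /elementary_continuous cf.
have /compact_bounded [M [_ HM]] : compact (f @` box r).
  by apply: continuous_compact; [exact: continuous_subspaceT|exact: box_compact].
exists (`|M| + 1); split=> [|x bx]; first by rewrite addr_ge0.
by apply: HM; [rewrite (le_lt_trans (ler_norm _))// ltrDl|exists x].
Qed.

(** A box is convex, so the mean value theorem on the segment from y to x applies
    and the partial derivatives are bounded there. *)
Lemma elementary_lipschitz f r : elementary f ->
  exists L, 0 <= L /\ forall x y, box r x -> box r y ->
    `|f x - f y| <= L * \sum_k `|x 0 k - y 0 k|.
Proof.
move=> ef.
have /choice[M HM] : forall k, exists M, 0 <= M /\
    forall x, box r x -> `|partial k f x| <= M.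
  by move=> k; apply/elementary_box_bound/elementary_partial.
exists (\sum_k M k); split=> [|x y bx by_].
  by apply: sumr_ge0 => k _; have [] := HM k.
pose c (s : R) := y + s *: (x - y).
have dc k (s : R) : is_derive s 1 (coordinate c k) (x 0 k - y 0 k).
  have -> : coordinate c k = fun s => y 0 k + s * (x 0 k - y 0 k).
    by apply/funext => u; rewrite /coordinate !mxE.
  apply: (der1_eq (der1_add (der1_cst _ _) (der1_mul (der1_id s) (der1_cst _ _)))).
  by rewrite mul1r mulr0 addr0 add0r.
have dfc s := elementary_has_gradient ef (fun k => dc k s).
have cfc : {within `[0, 1], continuous (fun s => f (c s))}.
  by apply: continuous_subspaceT => t; exact: der1_continuous (dfc t).
have [s] := MVT_segment ler01 (fun t _ => dfc t) cfc.
rewrite in_itv/= => /andP[s0 s1].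
have -> : c 1 = x by rewrite /c scale1r addrC subrK.
have -> : c 0 = y by rewrite /c scale0r addr0.
rewrite subr0 mulr1 => ->.
apply: le_trans (ler_norm_sum _ _ _) _; rewrite mulr_sumr; apply: ler_sum => k _.
rewrite normrM mulrC ler_wpM2r//; apply: le_trans (_ : M k <= _); last first.
  by rewrite (bigD1 k)//= lerDl sumr_ge0// => j _; have [] := HM j.
apply: (HM k).2 => i; rewrite /c !mxE.
have -> : y 0 i + s * (x 0 i - y 0 i) = s * x 0 i + (1 - s) * y 0 i by ring.
apply: le_trans (ler_normD _ _) _; have s2 : 0 <= 1 - s by rewrite subr_ge0.
rewrite !normrM (ger0_norm s0) (ger0_norm s2).
apply: (@le_trans _ _ (s * r + (1 - s) * r)); last by rewrite -mulrDl addrC subrK mul1r.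
apply: lerD; first by apply: ler_wpM2l => //; exact: bx.
by apply: ler_wpM2l => //; exact: by_.
Qed.

Lemma integral_curve_unique (X : 'rV[R]_n -> 'rV[R]_n) (c e : R -> 'rV[R]_n) (a : R) :
  elementary_mx X ->
  (forall k (t : R), is_derive t 1 (coordinate c k) (X (c t) 0 k)) ->
  (forall k (t : R), is_derive t 1 (coordinate e k) (X (e t) 0 k)) ->
  c a = e a -> forall t, a <= t -> c t = e t.
Proof.
move=> eX dc de cea.
suff H t : a <= t -> forall k, coordinate c k t - coordinate e k t = 0.
  move=> t at_; apply/rowP => k; apply/eqP; rewrite -subr_eq0; apply/eqP.
  exact: (H t at_ k).
have dd k (u : R) := der1_sub (dc k u) (de k u).
move: t; apply: (ode_zero dd) => [k|b].
  by rewrite /coordinate cea subrr.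
have bd (h : R -> 'rV[R]_n) :
    (forall k (t : R), is_derive t 1 (coordinate h k) (X (h t) 0 k)) ->
    exists r, 0 <= r /\ forall t, a <= t <= b -> box r (h t).
  move=> dh.
  have /choice[M HM] : forall k, exists M, 0 <= M /\
      forall t, a <= t <= b -> `|coordinate h k t| <= M.
    by move=> k; apply: continuous_itv_bound => t; exact: der1_continuous (dh k t).
  exists (\sum_k M k); split=> [|t tab k].
    by apply: sumr_ge0 => k _; have [] := HM k.
  apply: le_trans ((HM k).2 t tab) _.
  by rewrite (bigD1 k)//= lerDl sumr_ge0// => j _; have [] := HM j.
have [r1 [r10 b1]] := bd c dc; have [r2 [r20 b2]] := bd e de.
have /choice[L HL] : forall k, exists L, 0 <= L /\ forall x y,
    box (r1 + r2) x -> box (r1 + r2) y ->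
    `|X x 0 k - X y 0 k| <= L * \sum_k `|x 0 k - y 0 k|.
  by move=> k; apply: (elementary_lipschitz (f := fun x => X x 0 k)).
exists (\sum_k L k) => t tab k; apply: le_trans ((HL k).2 _ _ _ _) _.
- by move=> i; apply: le_trans (b1 t tab i) _; rewrite lerDl.
- by move=> i; apply: le_trans (b2 t tab i) _; rewrite lerDr.
rewrite ler_wpM2r ?sumr_ge0//.
by rewrite (bigD1 k)//= lerDl sumr_ge0// => j _; have [] := HL j.
Qed.

End Lipschitz.

Section SquaredNorm.
Context {R : realType} {n : nat}.

Lemma sqnormE (v : 'rV[R]_n) : (v *m v^T) 0 0 = \sum_k v 0 k ^+ 2.
Proof. by rewrite mxE; apply: eq_bigr => k _; rewrite mxE expr2. Qed.

Lemma sqnorm_gt0 (v : 'rV[R]_n) : v != 0 -> 0 < (v *m v^T) 0 0.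
Proof.
move=> v0; rewrite sqnormE lt_neqAle eq_sym; apply/andP; split; last first.
  by apply: sumr_ge0 => k _; exact: sqr_ge0.
apply: contraNneq v0 => /psumr_eq0P H; apply/eqP/rowP => k; rewrite mxE.
by apply/eqP; rewrite -sqrf_eq0; apply/eqP/H => // i _; exact: sqr_ge0.
Qed.

End SquaredNorm.

(** * Invisible directions from a phase function *)

Section Calibration.
Context {R : realType} {n : nat}.
Variables (g : 'rV[R]_n -> 'M[R]_n) (S : 'rV[R]_n -> R) (kappa : R).
Hypotheses (eg : elementary_mx g) (sg : forall x, (g x)^T = g x)
  (ug : forall x, g x \in unitmx) (eS : elementary S).
Let X := gradient_field g S.
Hypothesis eikonal : forall x, \sum_k partial k S x * X x 0 k = kappa.

Let eX : elementary_mx X := elementary_gradient_field eg ug eS.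

(** The defect c' - X (c) solves a homogeneous linear system of differential
    equations. It is linear because the quadratic terms of the geodesic equations
    of c and of X are subtracted, and q_i q_j - X_i X_j = q_i d_j + X_j d_i for
    d = q - X. *)
Lemma geodesic_follows_gradient (c : R -> 'rV[R]_n) (a : R) : geodesic g c ->
  (forall k, derive1 (coordinate c k) a = X (c a) 0 k) ->
  forall t, a <= t -> forall k, derive1 (coordinate c k) t = X (c t) 0 k.
Proof.
move=> gc ca.
pose q k t := derive1 (coordinate c k) t.
have dc k (t : R) : is_derive t 1 (coordinate c k) (q k t).
  by have [d1 _ _] := gc k t; split=> //; rewrite /q derive1E.
have dq k (t : R) : is_derive t 1 (q k)
    (- \sum_i \sum_j christoffel g k i j (c t) * q i t * q j t).
  have [_ d2 d3] := gc k t; split=> //.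
  by rewrite -derive1E; apply/eqP; rewrite -addr_eq0; apply/eqP.
have dX k (t : R) := elementary_has_gradient (eX 0 k) (fun i => dc i t).
(* The coefficients of the linear system for the defect. *)
pose A k j t := \sum_i (christoffel g k i j (c t) * q i t
   + christoffel g k j i (c t) * X (c t) 0 i) + partial j (fun y => X y 0 k) (c t).
have along f : elementary f -> forall t : R, exists a,
    is_derive t 1 (fun u => f (c u)) a.
  move=> ef t; exists (\sum_k q k t * partial k f (c t)).
  exact: (elementary_has_gradient ef (fun i => dc i t)).
have cA k j : continuous (A k j).
  move=> t.
  have /choice[dA HdA] : forall i : 'I_n, exists dA : R, is_derive t 1 (fun t =>
     christoffel g k i j (c t) * q i t
     + christoffel g k j i (c t) * X (c t) 0 i) dA.
    move=> i.
    have [a1 h1] := along _ (elementary_christoffel k i j eg ug) t.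
    have [a2 h2] := along _ (elementary_christoffel k j i eg ug) t.
    have [a3 h3] := along _ (eX 0 i) t.
    by eexists; exact: der1_add (der1_mul h1 (dq i t)) (der1_mul h2 h3).
  have [a4 h4] := along _ (elementary_partial j (eX 0 k)) t.
  exact: der1_continuous (der1_add (der1_sum HdA) h4).
suff H : forall t, a <= t -> forall k, q k t - X (c t) 0 k = 0.
  by move=> t /H{}H k; apply/eqP; rewrite -subr_eq0; apply/eqP; exact: H.
have dd k (t : R) : is_derive t 1 (fun u => q k u - X (c u) 0 k)
    (- \sum_j A k j t * (q j t - X (c t) 0 j)).
  apply: (der1_eq (der1_sub (dq k t) (dX k t))).
  have G := geodesic_gradient_field eg sg ug eS eikonal k (c t).
  rewrite -opprD; congr (- _); rewrite -[LHS]subr0 -[X in _ - X]G.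
  rewrite opprD addrACA -!sumrB /A.
  under [RHS]eq_bigr do rewrite mulrDl.
  rewrite [RHS]big_split/=; congr (_ + _); last first.
    by apply: eq_bigr => j _; rewrite /X; ring.
  under [RHS]eq_bigr do rewrite mulr_suml.
  under [RHS]eq_bigr do under eq_bigr do rewrite mulrDl.
  under [RHS]eq_bigr do rewrite big_split/=.
  rewrite [RHS]big_split/= [X in _ = X + _]exchange_big/= -big_split/=.
  apply: eq_bigr => i _; rewrite -sumrB -big_split/=.
  by apply: eq_bigr => j _; rewrite -/X; ring.
apply: (linear_ode_zero dd cA) => k.
by apply/eqP; rewrite subr_eq0; apply/eqP; exact: ca.
Qed.

(** For t < t0 the velocity is v because c is the line near t; from any such
    time on [geodesic_follows_gradient] applies. *)
Lemma incoming_line_follows_gradient (c : R -> 'rV[R]_n) (p v : 'rV[R]_n) (t0 : R) :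
  geodesic g c -> (forall t, t <= t0 -> c t = p + t *: v) ->
  (forall t, t <= t0 -> X (p + t *: v) = v) ->
  forall k (t : R), is_derive t 1 (coordinate c k) (X (c t) 0 k).
Proof.
move=> gc cl Xl.
have before k (t : R) : t < t0 -> derive1 (coordinate c k) t = X (c t) 0 k.
  move=> tt0; rewrite cl ?(ltW tt0)// Xl ?(ltW tt0)// derive1E.
  have dl : is_derive t 1 (fun u => p 0 k + u * v 0 k) (v 0 k).
    apply: (der1_eq (der1_add (der1_cst _ _) (der1_mul (der1_id t) (der1_cst _ _)))).
    by rewrite mul1r mulr0 addr0 add0r.
  have : is_derive t 1 (coordinate c k) (v 0 k).
    apply: (der1_near _ dl); near=> u.
    rewrite /coordinate cl ?mxE//; near: u; exact: lt_le_nbhsl.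
  by case.
move=> k t; have [d1 _ _] := gc k t; split=> //; rewrite -derive1E.
have [tt|tt] := ltP t (t0 - 1); first by apply: before; rewrite (lt_trans tt)// ltrBlDr ltrDl.
apply: (geodesic_follows_gradient gc _ tt) => j.
by apply: before; rewrite ltrBlDr ltrDl.
Unshelve. all: by end_near. Qed.

(** An integral curve of a constant field is a line, with no shift and no delay. *)
Lemma straight_direction (K : set 'rV[R]_n) (v : 'rV[R]_n) : v != 0 ->
  (forall x, X x = v) -> invisible_direction g K v.
Proof.
move=> v0 Xv; split=> // c p t0 gc cl _.
have dc := incoming_line_follows_gradient gc cl (fun t _ => Xv _).
have dl k (t : R) : is_derive t 1 (coordinate (fun t => p + t *: v) k)
    (X (p + t *: v) 0 k).
  have -> : coordinate (fun t => p + t *: v) k = fun u => p 0 k + u * v 0 k.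
    by apply/funext => u; rewrite /coordinate !mxE.
  rewrite Xv.
  apply: (der1_eq (der1_add (der1_cst _ _) (der1_mul (der1_id t) (der1_cst _ _)))).
  by rewrite mul1r mulr0 addr0 add0r.
exists t0, 0 => t t0t; rewrite addr0.
exact: (integral_curve_unique eX dc dl (cl t0 (lexx _)) t0t).
Qed.

(** S grows along c at the constant rate kappa, so c crosses the mirror S = 0 at a
    time tau. The curve t |-> c (2 tau - t) M is again an integral curve of X and
    agrees with c at tau, hence c is symmetric with respect to the mirror. The
    delay is the coefficient a of the reflection of p, shifted by 2 tau. *)
Lemma mirror_direction (K : set 'rV[R]_n) (r : R) (v : 'rV[R]_n) (M : 'M[R]_n) :
  v != 0 -> K `<=` box r -> 0 < kappa ->
  (forall x, ~ K x -> X x = v) ->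
  (forall x, ~ K x -> S x = (x *m v^T) 0 0) ->
  (forall x, X (x *m M) = - (X x *m M)) ->
  (forall x, S x = 0 -> x *m M = x) ->
  v *m M = - v -> (forall x, exists a, x *m M = x + a *: v) ->
  invisible_direction g K v.
Proof.
move=> v0 Kr kp XK SK XM SM vM pM; split=> // c p t0 gc cl _.
pose N := (v *m v^T) 0 0.
have N0 : 0 < N by exact: sqnorm_gt0.
pose P := (p *m v^T) 0 0.
have lineE t : ((p + t *: v) *m v^T) 0 0 = P + t * N.
  by rewrite mulmxDl -scalemxAl mxE [X in _ + X]mxE.
pose C := r * \sum_k `|v 0 k|.
(* Before the time T the incoming line is outside the box, where <v, .> is at most
   C in absolute value, and on the negative side of the mirror. *)
pose T := Order.min t0 (- ((`|C| + `|P| + 1) / N)).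
have line_out t : t <= T -> ~ K (p + t *: v) /\ P + t * N < 0.
  rewrite le_min => /andP[_]; rewrite -mulNr ler_pdivlMr// => tN.
  split=> [/Kr bx|]; last first.
    apply: le_lt_trans (lerD (lexx P) tN) _.
    have := ler_norm P; have := normr_ge0 C; lra.
  have : `|((p + t *: v) *m v^T) 0 0| <= C.
    rewrite mxE; apply: le_trans (ler_norm_sum _ _ _) _.
    rewrite /C mulr_sumr; apply: ler_sum => k _.
    by rewrite normrM [v^T _ _]mxE ler_wpM2r.
  rewrite lineE ler_norml => /andP[+ _].
  have := ler_norm P; have := ler_norm C; lra.
have Tt0 : T <= t0 by rewrite /T ge_min lexx.
have clT t : t <= T -> c t = p + t *: v by move=> tT; apply: cl; exact: le_trans Tt0.
have dc := incoming_line_follows_gradient gc clT (fun t tT => XK _ (line_out t tT).1).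
have dS (t : R) : is_derive t 1 (fun u => S (c u)) kappa.
  apply: (der1_eq (elementary_has_gradient eS (fun k => dc k t))).
  by rewrite -(eikonal (c t)); apply: eq_bigr => k _; rewrite mulrC.
have cS : {within `[T, T - S (c T) / kappa], continuous (fun u => S (c u))}.
  by apply: continuous_subspaceT => t; exact: der1_continuous (dS t).
(* The crossing time, by the constant growth of S. *)
pose tau := T - S (c T) / kappa.
have ST : S (c T) < 0.
  have [nK PT] := line_out T (lexx _).
  by rewrite clT// SK// lineE.
have Ttau : T <= tau by rewrite lerDl -mulNr divr_ge0 ?(ltW kp)// oppr_ge0 ltW.
have Stau : S (c tau) = 0.
  have [s _] := MVT_segment Ttau (fun t _ => dS t) cS.
  rewrite {2}/tau addrAC subrr add0r mulrN mulrCA divff ?gt_eqF// mulr1.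
  by move=> /eqP; rewrite subr_eq addNr => /eqP.
pose e t := c (2 * tau - t) *m M.
have de k (t : R) : is_derive t 1 (coordinate e k) (X (e t) 0 k).
  have -> : coordinate e k = fun u => \sum_j coordinate c j (2 * tau - u) * M j k.
    by apply/funext => u; rewrite /coordinate /e mxE.
  have dr : is_derive t 1 (fun u => 2 * tau - u) (-1).
    apply: (der1_eq (der1_sub (der1_cst (2 * tau) t) (der1_id t))).
    by rewrite sub0r.
  have dj j := der1_mul (@der1_comp _ _ (fun u => 2 * tau - u) _ _ _
    (dc j (2 * tau - t)) dr) (der1_cst (M j k) t).
  apply: (der1_eq (der1_sum dj)).
  rewrite /e XM mxE mxE -sumrN; apply: eq_bigr => j _.
  by rewrite mulr0 addr0 mulN1r mulNr.
have ce : c tau = e tau.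
  by rewrite /e; have -> : 2 * tau - tau = tau; [ring|rewrite SM].
have [a pa] := pM p.
exists (2 * tau - T), (a - 2 * tau) => t tT.
have taut : tau <= t by apply: le_trans tT; move: Ttau; lra.
rewrite (integral_curve_unique eX dc de ce taut) /e clT; last by move: tT; lra.
rewrite mulmxDl pa -scalemxAl vM -addrA; congr (_ + _).
by rewrite scalerN -scaleNr -scalerDl; congr (_ *: _); ring.
Qed.

End Calibration.

(** * Curvature at a ridge *)

Section Curvature.
Context {R : realType} {n : nat}.
Implicit Types (f : 'rV[R]_n -> R) (g h : 'rV[R]_n -> 'M[R]_n) (x : 'rV[R]_n).

Lemma near_partial f f' i x : (\forall y \near x, f y = f' y) ->
  \forall y \near x, partial i f y = partial i f' y.
Proof.
by move=> ff'; apply: filterS (nbhs_interior ff') => y; exact: near_eq_derive.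
Qed.

Lemma near_christoffel g h k i j x : (\forall y \near x, g y = h y) ->
  \forall y \near x, christoffel g k i j y = christoffel h k i j y.
Proof.
move=> gh; have gab a b l : \forall y \near x,
    partial l (fun z => g z a b) y = partial l (fun z => h z a b) y.
  by apply: near_partial; apply: filterS gh => y ->.
pose same l y :=
    [/\ partial i (fun z => g z j l) y = partial i (fun z => h z j l) y,
        partial j (fun z => g z i l) y = partial j (fun z => h z i l) y &
        partial l (fun z => g z i j) y = partial l (fun z => h z i j) y].
have near_same l : nbhs x (same l).
  by near=> y; split; near: y; exact: gab.
have gl := filter_forall (nbhs_filter x) near_same.
apply: filterS2 gh gl => y gy gl.
rewrite /christoffel gy; congr (_ * _); apply: eq_bigr => l _.
by have [-> -> ->] := gl l.
Unshelve. all: by end_near. Qed.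

Lemma near_riemann_curvature g h l k i j x : (\forall y \near x, g y = h y) ->
  riemann_curvature g l k i j x = riemann_curvature h l k i j x.
Proof.
move=> gh.
have Gx a b c : christoffel g a b c x = christoffel h a b c x.
  exact: (nbhs_singleton (near_christoffel a b c gh)).
have dG m a b c : partial m (christoffel g a b c) x = partial m (christoffel h a b c) x.
  exact: (nbhs_singleton (near_partial m (near_christoffel a b c gh))).
by rewrite /riemann_curvature !dG; congr (_ + _); apply: eq_bigr => m _; rewrite !Gx.
Qed.

(** The first derivatives of g are x_i times the functions D below, so the
    Christoffel symbols vanish on the hyperplane x_i = 0. On it only the
    i-derivative of the symbol (i, j, j) survives in the curvature, and dividing
    by x_i gives its value. *)
Lemma riemann_curvature_ridge g (Q : 'rV[R]_n -> 'M[R]_n) (i j : 'I_n) x0 :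
  elementary_mx g -> (forall x, g x \in unitmx) -> elementary_mx Q ->
  (forall x, g x = 1%:M + x 0 i ^+ 2 *: Q x) -> x0 0 i = 0 -> i != j ->
  riemann_curvature g i j i j x0 = - Q x0 j j.
Proof.
move=> eg ug eQ gQ x0i ij.
pose D k b m x : R := 2 * (k == i)%:R * Q x b m + x 0 i * partial k (fun y => Q y b m) x.
have ei := @elementary_coord R n i.
have eD k b m : elementary (D k b m).
  apply: elementary_add; apply: elementary_mul => //; first exact: elementary_cst.
  exact: elementary_partial.
have dg k b m x : partial k (fun y => g y b m) x = x 0 i * D k b m x.
  have -> : (fun y => g y b m) =
      (fun y => (1%:M : 'M[R]_n) b m + y 0 i * (y 0 i * Q y b m)).
    by apply/funext => y; rewrite gQ !mxE mulrA.
  have eiQ := elementary_mul ei (eQ b m).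
  rewrite (partial_add k (elementary_cst _) (elementary_mul ei eiQ)) partial_cst.
  rewrite (partial_mulE k x ei eiQ) (partial_mulE k x ei (eQ b m)) partial_coord.
  by rewrite /D; ring.
pose F l a b x : R := 2^-1 * \sum_m invmx (g x) l m * (D a b m x + D b a m x - D m a b x).
have eF l a b : elementary (F l a b).
  apply: elementary_mul; first exact: elementary_cst.
  apply: elementary_sum => m; apply: elementary_mul.
    exact: elementary_invmx.
  by apply: elementary_sub => //; apply: elementary_add.
have GF l a b : christoffel g l a b = fun x => x 0 i * F l a b x.
  apply/funext => x; rewrite /christoffel /F mulrCA; congr (_ * _).
  by rewrite mulr_sumr; apply: eq_bigr => m _; rewrite !dg; ring.
have dG k l a b : partial k (christoffel g l a b) x0 = (k == i)%:R * F l a b x0.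
  by rewrite GF (partial_mulE k x0 ei (eF l a b)) partial_coord x0i mul0r addr0.
rewrite /riemann_curvature !dG eqxx mul1r [j == i]eq_sym (negbTE ij) mul0r subr0.
rewrite big1 ?addr0; last by move=> m _; rewrite !GF x0i !mul0r subrr.
rewrite /F (_ : invmx (g x0) = 1%:M); last first.
  by rewrite gQ x0i expr0n scale0r addr0 invmx1.
rewrite (bigD1 i)//= big1 ?addr0; last first.
  by move=> m mi; rewrite mxE eq_sym (negbTE mi) mul0r.
rewrite mxE eqxx mul1r /D x0i !mul0r eqxx [j == i]eq_sym (negbTE ij).
by rewrite mulr0n mulr1n; field.
Qed.
End Curvature.

(** * From curvature to a family of metrics *)

Section Families.
Context {R : realType}.

(** An injection of the line into the parameters that are allowed below; the
    bound 1 / 44 is used in [slope_bounds]. *)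
Definition amplitude (s : R) : R := 44%:R^-1 * (1 + expR s)^-1.

Lemma amplitude_gt0 s : 0 < amplitude s.
Proof. by rewrite mulr_gt0 ?invr_gt0 ?addr_gt0 ?expR_gt0// ltr0n. Qed.

Lemma amplitude_le s : amplitude s <= 44%:R^-1.
Proof.
rewrite /amplitude ler_piMr ?invr_ge0//.
by rewrite invf_le1 ?lerDl ?expR_ge0// addr_gt0 ?expR_gt0.
Qed.

Lemma amplitude_inj : injective amplitude.
Proof.
move=> s t /(mulfI _) H; apply: expR_inj.
by apply: (addrI 1); apply: invr_inj; apply: H; rewrite invr_eq0 pnatr_eq0.
Qed.

Definition invisible_family (n N : nat) : Prop :=
  exists (K : set 'rV[R]_n) (g : R -> 'rV[R]_n -> 'M[R]_n),
    compact K /\ injective g /\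
    forall s : R,
      [/\ riemannian_metric (g s),
          euclidean_outside K (g s),
          ~ flat (g s)
        & exists v : 'I_N -> 'rV[R]_n,
            (forall i, invisible_direction (g s) K (v i)) /\
            (forall i j, i != j -> ~ parallel (v i) (v j))].

Section Criteria.
Context {n : nat}.
Implicit Types (g : 'rV[R]_n -> 'M[R]_n) (x v : 'rV[R]_n).

Lemma riemannian_elementary g : elementary_mx g -> (forall x, (g x)^T = g x) ->
  (forall x v, v != 0 -> 0 < (v *m g x *m v^T) 0 0) -> riemannian_metric g.
Proof. by move=> eg sg pg; split=> // i j; exact: elementary_smooth. Qed.

Lemma posdef_unitmx (A : 'M[R]_n) :
  (forall v : 'rV[R]_n, v != 0 -> 0 < (v *m A *m v^T) 0 0) -> A \in unitmx.
Proof.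
move=> pA; rewrite -row_free_unit; apply/inj_row_free => v vA.
apply/eqP; apply/negPn/negP => /pA.
by rewrite vA mul0mx mxE ltxx.
Qed.

Lemma family_of_curvature (g : R -> 'rV[R]_n -> 'M[R]_n) (l k i j : 'I_n) x (a : R) :
  (forall s, riemann_curvature (g s) l k i j x = a * amplitude s) -> a != 0 ->
  injective g /\ forall s, ~ flat (g s).
Proof.
move=> H a0; split=> [s t st|s fl].
  by apply: amplitude_inj; apply: (mulfI a0); rewrite -!H st.
by have /eqP := fl l k i j x; rewrite H mulf_eq0 (negbTE a0) gt_eqF ?amplitude_gt0.
Qed.

End Criteria.

(** * Dimension at least three *)

Section StraightFamily.
Context {n : nat}.
Variables (i j k : 'I_n).
Hypotheses (ij : i != j) (ik : i != k) (jk : j != k).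
Implicit Types x v : 'rV[R]_n.

Definition central_bump x : R := flat_exp 0 (1 - \sum_l x 0 l ^+ 2).

(** The factor (x_i)^2 is there for [riemann_curvature_ridge]. *)
Definition straight_metric (s : R) x : 'M[R]_n :=
  1%:M + x 0 i ^+ 2 *: ((amplitude s * central_bump x) *: delta_mx k k).

Lemma elementary_central_bump : elementary central_bump.
Proof.
apply: elementary_flat; apply: elementary_sub; first exact: elementary_cst.
by apply: elementary_sum => l; apply: elementary_pow; exact: elementary_coord.
Qed.

Lemma elementary_straight_metric s : elementary_mx (straight_metric s).
Proof.
move=> a b; under eq_fun do rewrite !mxE.
apply: elementary_add; first exact: elementary_cst.
apply: elementary_mul; first by apply: elementary_pow; exact: elementary_coord.
apply: elementary_mul; last exact: elementary_cst.
by apply: elementary_mul; [exact: elementary_cst|exact: elementary_central_bump].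
Qed.

Lemma straight_metric_sym s x : (straight_metric s x)^T = straight_metric s x.
Proof. by apply/matrixP => a b; rewrite !mxE [b == a]eq_sym andbC. Qed.

Lemma straight_metric_gt0 s x v : v != 0 ->
  0 < (v *m straight_metric s x *m v^T) 0 0.
Proof.
move=> v0; rewrite mulmxDr mulmx1 mulmxDl mxE ltr_wpDr ?sqnorm_gt0//.
rewrite -!scalemxAr -!scalemxAl !mxE.
rewrite mulr_ge0 ?sqr_ge0// mulr_ge0//.
  by rewrite mulr_ge0 ?flat_exp_ge0// ltW ?amplitude_gt0.
rewrite (bigD1 k)//= big1 ?addr0 => [|l lk]; last first.
  rewrite !mxE big1 ?mul0r// => m _.
  by rewrite !mxE (negbTE lk) andbF mulr0.
rewrite !mxE (bigD1 k)//= big1 ?addr0 => [|l lk]; last first.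
  by rewrite !mxE (negbTE lk) mulr0.
by rewrite mxE !eqxx mulr1 -expr2 sqr_ge0.
Qed.

Let straight_metric_unit s x := posdef_unitmx (straight_metric_gt0 s x).

Lemma straight_metric_curvature s :
  riemann_curvature (straight_metric s) i k i k 0 = - expR (-1) * amplitude s.
Proof.
have eQ : elementary_mx (fun x => (amplitude s * central_bump x) *:
    (delta_mx k k : 'M[R]_n)).
  move=> a b; under eq_fun do rewrite !mxE.
  apply: elementary_mul; last exact: elementary_cst.
  by apply: elementary_mul; [exact: elementary_cst|exact: elementary_central_bump].
rewrite (riemann_curvature_ridge (elementary_straight_metric s)
  (straight_metric_unit s) eQ (fun=> erefl) (mxE _ _ _ _) ik).
rewrite !mxE !eqxx mulr1 mulNr mulrC; congr (- (_ * _)).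
rewrite /central_bump big1 ?subr0 => [|l _]; last by rewrite mxE expr0n.
by rewrite /flat_exp ltr01 expr0 mul1r invr1.
Qed.

Lemma straight_metric_direction s (K : set 'rV[R]_n) v : v != 0 -> v 0 k = 0 ->
  invisible_direction (straight_metric s) K v.
Proof.
move=> v0 vk.
have eS : elementary (fun x => \sum_l v 0 l * x 0 l).
  apply: elementary_sum => l; apply: elementary_mul; first exact: elementary_cst.
  exact: elementary_coord.
have dS a x : partial a (fun x => \sum_l v 0 l * x 0 l) x = v 0 a.
  rewrite partial_sum => [|l]; last first.
    by apply: elementary_mul; [exact: elementary_cst|exact: elementary_coord].
  rewrite (bigD1 a)//= big1 ?addr0 => [|l la].
    rewrite (partial_mulE a x (elementary_cst _) (elementary_coord a)).
    by rewrite partial_cst partial_coord eqxx mul0r add0r mulr1.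
  rewrite (partial_mulE a x (elementary_cst _) (elementary_coord l)).
  by rewrite partial_cst partial_coord eq_sym (negbTE la) mul0r add0r mulr0.
have Xv x : gradient_field (straight_metric s) (fun x => \sum_l v 0 l * x 0 l) x = v.
  rewrite /gradient_field (_ : \row_a _ = v *m straight_metric s x) ?mulmxK//.
  apply/rowP => a; rewrite mulmxDr mulmx1 -!scalemxAr !mxE dS.
  rewrite big1 ?mulr0 ?addr0// => l _; rewrite mxE.
  by have [->|] := eqVneq l k; rewrite ?vk ?mul0r// mulr0.
apply: (straight_direction (kappa := \sum_a v 0 a * v 0 a)
  (elementary_straight_metric s) (straight_metric_sym s)
  (straight_metric_unit s) eS _ _ v0 Xv) => x.
by apply: eq_bigr => a _; rewrite dS Xv.
Qed.

Lemma straight_metric_euclidean s : euclidean_outside (box 1) (straight_metric s).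
Proof.
move=> x xb; rewrite /straight_metric /central_bump flat_exp_npos.
  by rewrite mulr0 scale0r scaler0 addr0.
have [l xl] : exists l, ~ `|x 0 l| <= 1 by apply/existsNP.
rewrite subr_le0 (bigD1 l)//= ler_wpDr ?sumr_ge0//.
  by move=> m _; exact: sqr_ge0.
by rewrite -real_normK ?num_real// exprn_ege1// ltW// ltNge; apply/negP.
Qed.

(** The directions e_i + a e_j, for natural numbers a, are orthogonal to e_k and
    pairwise not parallel. *)
Lemma straight_family N : invisible_family n N.
Proof.
have e0 : - expR (-1) != 0 :> R by rewrite oppr_eq0 gt_eqF ?expR_gt0.
have [gI gN] := family_of_curvature straight_metric_curvature e0.
exists (box 1), straight_metric; split; first exact: box_compact.
split=> // s; split=> //.
- by apply: riemannian_elementary; [exact: elementary_straight_metric|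
    exact: straight_metric_sym|exact: straight_metric_gt0].
- exact: straight_metric_euclidean.
exists (fun a : 'I_N => delta_mx 0 i + a%:R *: delta_mx 0 j); split.
  move=> a; apply: straight_metric_direction.
    apply/eqP => /rowP/(_ i); rewrite !mxE !eqxx/= (negbTE ij) mulr0 addr0.
    by move=> /eqP; rewrite oner_eq0.
  by rewrite !mxE eqxx/= ![k == _]eq_sym (negbTE ik) (negbTE jk) mulr0 addr0.
move=> a b ab [c _ E].
have := congr1 (fun v : 'rV_n => v 0 i) E; rewrite !mxE !eqxx/= (negbTE ij).
rewrite !mulr0 !addr0 mulr1 => c1.
have := congr1 (fun v : 'rV_n => v 0 j) E; rewrite !mxE !eqxx/= [j == i]eq_sym (negbTE ij).
rewrite !add0r !mulr1 -c1 mul1r => /eqP; rewrite eqr_nat => /eqP/val_inj ba.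
by rewrite ba eqxx in ab.
Qed.

End StraightFamily.
End Families.

(** * Linear maps of the plane *)

Section LinearComposition.
Context {R : realType} {n : nat}.

Lemma elementary_comp (f : 'rV[R]_n -> R) (L : 'M[R]_n) : elementary f ->
  elementary (fun x => f (x *m L)).
Proof.
elim=> [a|i|{}f h _ ef _ eh|{}f h _ ef _ eh|{}f _ ef f0|k {}f _ ef].
- exact: elementary_cst.
- under eq_fun do rewrite mxE.
  apply: elementary_sum => j; apply: elementary_mul; first exact: elementary_coord.
  exact: elementary_cst.
- exact: elementary_add.
- exact: elementary_mul.
- exact: elementary_inv.
- exact: elementary_flat.
Qed.

Lemma partial_comp (f : 'rV[R]_n -> R) (L : 'M[R]_n) i x : elementary f ->
  partial i (fun x => f (x *m L)) x = \sum_j L i j * partial j f (x *m L).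
Proof.
move=> ef; suff H : has_gradient (fun x => f (x *m L))
    (fun i x => \sum_j L i j * partial j f (x *m L)).
  by have /(congr1 (fun h => h i x)) := has_gradientE H.
move=> c t w cw.
have cL k : is_derive t 1 (coordinate (fun u => c u *m L) k) (\sum_l w l * L l k).
  have -> : coordinate (fun u => c u *m L) k = fun u => \sum_l coordinate c l u * L l k.
    by apply/funext => u; rewrite /coordinate mxE.
  apply: (der1_eq (der1_sum (fun l => der1_mul (cw l) (der1_cst (L l k) t)))).
  by apply: eq_bigr => l _; rewrite mulr0 addr0.
apply: (der1_eq (elementary_has_gradient ef cL)).
under eq_bigr do rewrite mulr_suml.
rewrite exchange_big; apply: eq_bigr => l _; rewrite mulr_sumr.
by apply: eq_bigr => k _; rewrite mulrA.
Qed.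

End LinearComposition.

Section Plane.
Context {R : realType}.

Definition mx2 (a b c d : R) : 'M[R]_2 :=
  \matrix_(i, j) if i == 0 then (if j == 0 then a else b)
                 else (if j == 0 then c else d).

Definition rv2 (a b : R) : 'rV[R]_2 := \row_j if j == 0 then a else b.

Lemma I2P (i : 'I_2) : {i = 0} + {i = 1}.
Proof. by case: i => [[|[|//]] Hi]; [left|right]; apply/val_inj. Qed.

Lemma rv2E (x : 'rV[R]_2) : x = rv2 (x 0 0) (x 0 1).
Proof. by apply/rowP => j; rewrite mxE; case: (I2P j) => ->. Qed.

Lemma mx2M a b c d a' b' c' d' : mx2 a b c d *m mx2 a' b' c' d' =
  mx2 (a * a' + b * c') (a * b' + b * d') (c * a' + d * c') (c * b' + d * d').
Proof.
apply/matrixP => i j; rewrite !mxE !big_ord_recl big_ord0 addr0 !mxE.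
by case: (I2P i) => ->; case: (I2P j) => ->.
Qed.

Lemma rv2M a b a' b' c' d' : rv2 a b *m mx2 a' b' c' d' =
  rv2 (a * a' + b * c') (a * b' + b * d').
Proof.
apply/rowP => j; rewrite !mxE !big_ord_recl big_ord0 addr0 !mxE.
by case: (I2P j) => ->.
Qed.

Lemma mx2D a b c d a' b' c' d' : mx2 a b c d + mx2 a' b' c' d' =
  mx2 (a + a') (b + b') (c + c') (d + d').
Proof. by apply/matrixP => i j; rewrite !mxE; case: ifP; case: ifP. Qed.

Lemma mx2_tr a b c d : (mx2 a b c d)^T = mx2 a c b d.
Proof. by apply/matrixP => i j; rewrite !mxE; case: ifP; case: ifP. Qed.

Lemma mx2_1 : 1%:M = mx2 1 0 0 1.
Proof.
by apply/matrixP => i j; rewrite !mxE; case: (I2P i) => ->; case: (I2P j) => ->.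
Qed.

Lemma rv2_dot a b a' b' : (rv2 a b *m (rv2 a' b')^T) 0 0 = a * a' + b * b'.
Proof. by rewrite !mxE !big_ord_recl big_ord0 addr0 !mxE. Qed.

(** The rotation by 120 degrees, acting on row vectors. *)
Definition rotation : 'M[R]_2 :=
  mx2 (- 2^-1) (Num.sqrt 3 / 2) (- (Num.sqrt 3 / 2)) (- 2^-1).
Local Notation Q := rotation.

Definition mirror : 'M[R]_2 := mx2 (-1) 0 0 1.

Lemma sqrt3_sqr : Num.sqrt 3 * Num.sqrt 3 = 3 :> R.
Proof. by rewrite -expr2 sqr_sqrtr. Qed.

Lemma rotation_tr : Q^T = mx2 (- 2^-1) (- (Num.sqrt 3 / 2)) (Num.sqrt 3 / 2) (- 2^-1).
Proof. by rewrite mx2_tr. Qed.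

Lemma rotation_sqr : Q *m Q = Q^T.
Proof.
rewrite rotation_tr mx2M; have := sqrt3_sqr; set r := Num.sqrt 3 => r3.
by congr mx2; lra.
Qed.

Lemma rotation_mul_tr : Q *m Q^T = 1%:M.
Proof.
rewrite rotation_tr mx2M mx2_1; have := sqrt3_sqr; set r := Num.sqrt 3 => r3.
by congr mx2; lra.
Qed.

Lemma rotation_tr_mul : Q^T *m Q = 1%:M.
Proof. exact: mulmx1C rotation_mul_tr. Qed.

Lemma rotation_tr_sqr : Q^T *m Q^T = Q.
Proof. by rewrite -trmx_mul rotation_sqr trmxK. Qed.

Lemma mirror_mul : mirror *m mirror = 1%:M.
Proof. by rewrite mx2M mx2_1; congr mx2; ring. Qed.

Lemma mirror_rotation : mirror *m Q = Q^T *m mirror.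
Proof. by rewrite rotation_tr !mx2M; congr mx2; ring. Qed.

Lemma mirror_rotation_tr : mirror *m Q^T = Q *m mirror.
Proof. by rewrite rotation_tr !mx2M; congr mx2; ring. Qed.

(** Positive exactly on the disc of radius one around (0, 2). *)
Definition profile (x : 'rV[R]_2) : R := 1 - x 0 0 ^+ 2 - (x 0 1 - 2) ^+ 2.

Lemma profile_gt0 x : 0 < profile x ->
  [/\ -1 <= x 0 0 <= 1, -1 <= x 0 1 - 2 <= 1, x 0 0 ^+ 2 <= 1 & (x 0 1 - 2) ^+ 2 <= 1].
Proof.
rewrite /profile => h; have := sqr_ge0 (x 0 0); have := sqr_ge0 (x 0 1 - 2) => h1 h2.
have a : x 0 0 ^+ 2 <= 1 by lra.
have b : (x 0 1 - 2) ^+ 2 <= 1 by lra.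
by split=> //; rewrite -ler_norml -(@ler_pXn2r _ 2) ?nnegrE// expr1n real_normK ?num_real.
Qed.

(** On the disc the second coordinate exceeds one; after a rotation by 120 degrees
    it is below sqrt 3 / 2 - 1 / 2. So the three rotated discs are disjoint. *)
Lemma profile_rotation x : 0 < profile x ->
  profile (x *m Q) <= 0 /\ profile (x *m Q^T) <= 0.
Proof.
move=> /profile_gt0[/andP[x1 x2] /andP[x3 x4] _ _].
have r3 := sqrt3_sqr; have r0 : 0 <= Num.sqrt 3 :> R by exact: sqrtr_ge0.
have r2 : Num.sqrt 3 <= 2 :> R by nra.
have key (u y : R) : y <= 1 -> 1 - u ^+ 2 - (y - 2) ^+ 2 <= 0.
  move=> y1; have := sqr_ge0 u; have : 1 <= (y - 2) ^+ 2 by rewrite expr2; nra.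
  lra.
rewrite rotation_tr [x]rv2E !rv2M /profile !mxE /=; split; apply: key.
- nra.
- nra.
Qed.

Lemma elementary_mx_diag a d : elementary a -> elementary d ->
  elementary_mx (fun x : 'rV[R]_2 => mx2 (a x) 0 0 (d x)).
Proof.
move=> ea ed i j.
by case: (I2P i) => ->; case: (I2P j) => ->; under eq_fun do rewrite mxE/=;
  rewrite //; exact: elementary_cst.
Qed.

Lemma mx2_diag_gt0 a d (v : 'rV[R]_2) : 0 < a -> 0 < d -> v != 0 ->
  0 < (v *m mx2 a 0 0 d *m v^T) 0 0.
Proof.
move=> a0 d0; rewrite [v]rv2E rv2M rv2_dot; move: (v 0 0) (v 0 1) => u w uw.
have [u0|u0] := eqVneq u 0; last first.
  have : 0 < u ^+ 2 by rewrite exprn_even_gt0.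
  by have := sqr_ge0 w; nra.
have w0 : w != 0.
  by apply: contraNneq uw => ->; rewrite u0; apply/eqP/rowP => j; rewrite !mxE; case: ifP.
have : 0 < w ^+ 2 by rewrite exprn_even_gt0.
by rewrite u0; nra.
Qed.

Lemma elementary_profile : elementary profile.
Proof.
have e0 := @elementary_coord R 2 0; have e1 := @elementary_coord R 2 1.
apply: elementary_sub; last first.
  by apply: elementary_pow; apply: elementary_sub => //; exact: elementary_cst.
by apply: elementary_sub; [exact: elementary_cst|exact: elementary_pow].
Qed.

Lemma profile_far (x : 'rV[R]_2) (L : 'M[R]_2) : L *m L^T = 1%:M -> ~ box 10 x ->
  profile (x *m L) <= 0.
Proof.
move=> LL; apply: contra_notP => /negP; rewrite -ltNge.
have : (x *m L *m (x *m L)^T) 0 0 = (x *m x^T) 0 0.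
  by rewrite trmx_mul mulmxA -[_ *m L *m L^T]mulmxA LL mulmx1.
rewrite !sqnormE !big_ord_recl !big_ord0 !addr0.
have -> : lift ord0 ord0 = 1 :> 'I_2 by apply/val_inj.
set y := x *m L => E /profile_gt0[/andP[u1 u2] /andP[v1 v2] u3 v3] i.
have yy : x 0 0 ^+ 2 + x 0 1 ^+ 2 <= 100%:R.
  by rewrite -E; nra.
have i10 : x 0 i ^+ 2 <= 10%:R ^+ 2.
  have := sqr_ge0 (x 0 0); have := sqr_ge0 (x 0 1).
  by case: (I2P i) => ->; lra.
by rewrite -(@ler_pXn2r _ 2) ?nnegrE// real_normK ?num_real.
Qed.

End Plane.

(** * The hexagonal metric *)

Section HexagonalMetric.
Context {R : realType}.
Variable eps : R.
Hypotheses (eps_gt0 : 0 < eps) (eps_le : eps <= 44%:R^-1).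
Local Notation Q := (@rotation R).
Implicit Types x y : 'rV[R]_2.

Definition hex_bump k x : R := flat_exp k (profile x).

(** Odd in the first coordinate, as the mirror argument requires. The cube makes
    the second derivatives vanish on the mirror, so that the metric differs from
    the Euclidean one by a multiple of (x_0)^2. *)
Definition phase x : R := x 0 0 + eps * x 0 0 ^+ 3 * hex_bump 0 x.

Definition slope_x x : R :=
  1 + eps * x 0 0 ^+ 2 * (3 * hex_bump 0 x - 2 * x 0 0 ^+ 2 * hex_bump 2 x).

Definition slope_y x : R := - (2 * eps * x 0 0 ^+ 3 * (x 0 1 - 2) * hex_bump 2 x).

Local Notation p := slope_x.
Local Notation q := slope_y.

Lemma elementary_hex_bump k : elementary (hex_bump k).
Proof. exact/elementary_flat/elementary_profile. Qed.

Lemma elementary_slope_x : elementary p.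
Proof.
have e0 := @elementary_coord R 2 0; have ec a := @elementary_cst R 2 a.
have eb := elementary_hex_bump.
apply: elementary_add => //; apply: elementary_mul.
  by apply: elementary_mul => //; exact: elementary_pow.
apply: elementary_sub; apply: elementary_mul => //.
by apply: elementary_mul => //; exact: elementary_pow.
Qed.

Lemma elementary_slope_y : elementary q.
Proof.
have e0 := @elementary_coord R 2 0; have ec a := @elementary_cst R 2 a.
have e1 := @elementary_coord R 2 1; have eb := elementary_hex_bump.
apply: elementary_opp; apply: elementary_mul => //.
apply: elementary_mul; last exact: elementary_sub.
by apply: elementary_mul; [exact: elementary_mul|exact: elementary_pow].
Qed.

Lemma elementary_phase : elementary phase.
Proof.
have e0 := @elementary_coord R 2 0; have ec a := @elementary_cst R 2 a.
have eb := elementary_hex_bump.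
apply: elementary_add => //; apply: elementary_mul => //.
by apply: elementary_mul => //; exact: elementary_pow.
Qed.

Lemma has_gradient_phase :
  has_gradient phase (fun i x => if i == 0 then p x else q x).
Proof.
move=> c t w cw; rewrite !big_ord_recl big_ord0 addr0 /=.
set w0 := w 0; set w1 := w (lift ord0 ord0).
have d0 : is_derive t 1 (fun u => c u 0 0) w0 := cw 0.
have d1 : is_derive t 1 (fun u => c u 0 1) w1.
  have -> : 1 = lift ord0 ord0 :> 'I_2 by apply/val_inj.
  exact: cw.
have sq (f : R -> R) a : is_derive t 1 f a ->
    is_derive t 1 (fun u => f u ^+ 2) (2 * f t * a).
  move=> df; have -> : (fun u => f u ^+ 2) = (fun u => f u * f u).
    by apply/funext => u; rewrite expr2.
  by apply: (der1_eq (der1_mul df df)); ring.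
have dp := der1_sub (der1_sub (der1_cst 1 t) (sq _ _ d0))
  (sq _ _ (der1_sub d1 (der1_cst 2 t))).
have db := @der1_comp _ (flat_exp 0) (fun u => profile (c u)) _ _ _
  (is_derive_flat_exp 0 (profile (c t))) dp.
have dx3 := der1_mul (sq _ _ d0) d0.
have dS := der1_add d0 (der1_mul (der1_mul (der1_cst eps t) dx3) db).
have -> : (fun u => phase (c u)) = (fun u => c u 0 0 +
   eps * (c u 0 0 ^+ 2 * c u 0 0) * flat_exp 0 (profile (c u))).
  by apply/funext => u; rewrite /phase /hex_bump exprSr.
apply: (der1_eq dS).
by rewrite /slope_x /slope_y /hex_bump; ring.
Qed.

Lemma gradient_phase x : \row_k partial k phase x = rv2 (p x) (q x).
Proof.
apply/rowP => j; rewrite !mxE.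
by have /(congr1 (fun h => h j x)) <- := has_gradientE has_gradient_phase.
Qed.

Lemma hex_bump_out k x : profile x <= 0 -> hex_bump k x = 0.
Proof. exact: flat_exp_npos. Qed.

Lemma slope_x_out x : profile x <= 0 -> p x = 1.
Proof. by move=> h; rewrite /slope_x !hex_bump_out// !mulr0 subr0 mulr0 addr0. Qed.

Lemma slope_y_out x : profile x <= 0 -> q x = 0.
Proof. by move=> h; rewrite /slope_y hex_bump_out// mulr0 oppr0. Qed.

Lemma eps_sqr_le : eps ^+ 2 <= 1 / 1024%:R.
Proof.
apply: (@le_trans _ _ (44%:R^-1 ^+ 2)).
  by rewrite ler_pXn2r ?nnegrE ?invr_ge0// ltW.
by lra.
Qed.

Lemma slope_bounds x : 3 / 4 <= p x /\ q x ^+ 2 <= 1 / 16.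
Proof.
have [h|h] := leP (profile x) 0.
  by rewrite slope_x_out// slope_y_out// expr0n/=; split; lra.
have [/andP[u1 u2] /andP[v1 v2] u3 v3] := profile_gt0 h.
have b0 : 0 <= hex_bump 0 x := flat_exp_ge0 _ _.
have b2 : 0 <= hex_bump 2 x := flat_exp_ge0 _ _.
have b2' : hex_bump 2 x <= 4 by apply: le_trans (flat_exp_le _ _) _; rewrite -natrX.
rewrite /slope_x /slope_y; set B0 := hex_bump 0 x; set B2 := hex_bump 2 x.
set u := x 0 0; set v := x 0 1 - 2.
have u0 : 0 <= u ^+ 2 by exact: sqr_ge0.
have v0 : 0 <= v ^+ 2 by exact: sqr_ge0.
have uB : 0 <= u ^+ 2 * B2 <= 4.
  rewrite mulr_ge0//= -[leRHS]mul1r; apply: ler_pM => //.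
(* On the disc u^2 <= 1, v^2 <= 1 and B2 <= 2^2, so p - 1 >= - 8 eps and
   q^2 <= 64 eps^2. *)
have e44 : eps * 44%:R <= 1 by rewrite -ler_pdivlMr// div1r.
split.
  have U : u ^+ 2 * (3 * B0 - 2 * u ^+ 2 * B2) >= - 8%:R.
    have : 0 <= u ^+ 2 * B0 by exact: mulr_ge0.
    have : u ^+ 2 * (u ^+ 2 * B2) <= 4.
      by rewrite -[leRHS]mul1r; apply: ler_pM => //; case/andP: uB.
    nra.
  rewrite -mulrA; move: U; set W := u ^+ 2 * (_ - _) => U.
  have : 0 <= eps * (W + 8%:R) by rewrite mulr_ge0 ?(ltW eps_gt0)//; lra.
  lra.
have -> : (- (2 * eps * u ^+ 3 * v * B2)) ^+ 2 =
   4 * eps ^+ 2 * (u ^+ 2 * B2) ^+ 2 * (u ^+ 2 * v ^+ 2) by ring.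
have uv : 0 <= u ^+ 2 * v ^+ 2 <= 1.
  by rewrite mulr_ge0//= -[leRHS]mul1r; apply: ler_pM.
have uB2 : 0 <= (u ^+ 2 * B2) ^+ 2 <= 16%:R.
  move: uB; set z := u ^+ 2 * B2 => /andP[z0 z4]; rewrite sqr_ge0/=.
  have : 0 <= (4 - z) * (4 + z) by rewrite mulr_ge0//; lra.
  lra.
have ee : 0 <= eps ^+ 2 <= 1 / 1024%:R by rewrite sqr_ge0 eps_sqr_le.
move: uv uB2 ee; set z := (u ^+ 2 * B2) ^+ 2; set w := u ^+ 2 * v ^+ 2; set e := eps ^+ 2.
move=> /andP[w0 w1] /andP[z0 z1] /andP[e0 e1].
have zw : z * w <= 16%:R by rewrite -[leRHS]mulr1; apply: ler_pM.
have : e * (z * w) <= 1 / 1024%:R * 16%:R by apply: ler_pM => //; exact: mulr_ge0.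
lra.
Qed.

(** The common factor of both dents; see [excessE]. *)
Definition excess x : R :=
  let P := 3 * hex_bump 0 x - 2 * x 0 0 ^+ 2 * hex_bump 2 x in
  let T := 2 * (x 0 1 - 2) * hex_bump 2 x in
  eps * (2 * P + eps * x 0 0 ^+ 2 * (P ^+ 2 + x 0 0 ^+ 2 * T ^+ 2)).

Lemma excessE x : x 0 0 ^+ 2 * excess x = p x ^+ 2 + q x ^+ 2 - 1.
Proof. by rewrite /excess /slope_x /slope_y /=; ring. Qed.

(** [dent_x] and [dent_y] are [metric_x] - 1 and [metric_y] - 1 divided by (x_0)^2,
    in a form that is elementary also where x_0 = 0; see [dented_metricE]. *)
Definition dent_x x : R := 3 * excess x * (3 - 4 * q x ^+ 2)^-1.
Definition dent_y x : R := - (excess x * (4 * p x ^+ 2 - 1)^-1).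

Lemma slope_x_den x : 0 < 4 * p x ^+ 2 - 1.
Proof. by have [] := slope_bounds x; nra. Qed.

Lemma slope_y_den x : 0 < 3 - 4 * q x ^+ 2.
Proof. by have [_] := slope_bounds x; lra. Qed.

Lemma slope_num x : 0 < 3 * p x ^+ 2 - q x ^+ 2.
Proof. by have [] := slope_bounds x; nra. Qed.

Lemma elementary_excess : elementary excess.
Proof.
have e0 := @elementary_coord R 2 0; have ec a := @elementary_cst R 2 a.
have e1 := @elementary_coord R 2 1; have eb := elementary_hex_bump.
have eP : elementary (fun x => 3 * hex_bump 0 x - 2 * x 0 0 ^+ 2 * hex_bump 2 x).
  apply: elementary_sub; apply: elementary_mul => //.
  by apply: elementary_mul => //; exact: elementary_pow.
have eT : elementary (fun x => 2 * (x 0 1 - 2) * hex_bump 2 x).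
  by apply: elementary_mul => //; apply: elementary_mul => //; exact: elementary_sub.
have eu := elementary_pow 2 e0.
apply: elementary_mul => //; apply: elementary_add; first exact: elementary_mul.
apply: elementary_mul; first exact: elementary_mul.
apply: elementary_add; first exact: elementary_pow.
by apply: elementary_mul => //; exact: elementary_pow.
Qed.

Lemma elementary_dent_x : elementary dent_x.
Proof.
have ec a := @elementary_cst R 2 a.
apply: elementary_mul; first by apply: elementary_mul => //; exact: elementary_excess.
apply: elementary_inv => [|x]; last by rewrite gt_eqF ?slope_y_den.
apply: elementary_sub => //; apply: elementary_mul => //.
exact/elementary_pow/elementary_slope_y.
Qed.

Lemma elementary_dent_y : elementary dent_y.
Proof.
have ec a := @elementary_cst R 2 a.
apply: elementary_opp; apply: elementary_mul; first exact: elementary_excess.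
apply: elementary_inv => [|x]; last by rewrite gt_eqF ?slope_x_den.
apply: elementary_sub => //; apply: elementary_mul => //.
exact/elementary_pow/elementary_slope_x.
Qed.

Definition dent x : 'M[R]_2 := x 0 0 ^+ 2 *: mx2 (dent_x x) 0 0 (dent_y x).

(** The diagonal metric with entries A = [metric_x] and B = [metric_y] is the
    solution of p^2 / A + q^2 / B = 1 and (1 / 4) / A + (3 / 4) / B = 1, the eikonal
    equations of the bent phase, with differential (p, q), and of the two linear
    phases, with differentials (- 1 / 2, +- sqrt 3 / 2). It is positive as soon as
    p > 1 / 2 and q^2 < 3 / 4. *)
Definition metric_x x : R := (3 * p x ^+ 2 - q x ^+ 2) / (3 - 4 * q x ^+ 2).
Definition metric_y x : R := (3 * p x ^+ 2 - q x ^+ 2) / (4 * p x ^+ 2 - 1).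

Lemma metric_x_gt0 x : 0 < metric_x x.
Proof. by rewrite divr_gt0 ?slope_num ?slope_y_den. Qed.

Lemma metric_y_gt0 x : 0 < metric_y x.
Proof. by rewrite divr_gt0 ?slope_num ?slope_x_den. Qed.

Lemma dented_metricE x : 1%:M + dent x = mx2 (metric_x x) 0 0 (metric_y x).
Proof.
have px := slope_x_den x; have qx := slope_y_den x.
have -> : dent x = mx2 (x 0 0 ^+ 2 * dent_x x) 0 0 (x 0 0 ^+ 2 * dent_y x).
  by apply/matrixP => i j; rewrite !mxE; case: ifP; case: ifP; rewrite ?mulr0.
rewrite mx2_1 mx2D; congr mx2; rewrite ?addr0//.
  rewrite /dent_x mulrA [_ * (3 * _)]mulrCA excessE /metric_x.
  by field; rewrite gt_eqF.
rewrite /dent_y mulrN mulrA excessE /metric_y.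
by field; rewrite gt_eqF.
Qed.

Lemma dent_out x : profile x <= 0 -> dent x = 0.
Proof.
move=> h; rewrite /dent /dent_x /dent_y /excess /= !hex_bump_out//.
rewrite !(mulr0, subr0, expr0n, addr0, mul0r, oppr0).
by apply/matrixP => i j; rewrite !mxE; case: ifP; case: ifP; rewrite ?mulr0.
Qed.

(** The sum over the three rotations; at each point at most one of the dents is
    different from zero. *)
Definition hexagonal_metric x : 'M[R]_2 :=
  1%:M + dent x + Q^T *m dent (x *m Q^T) *m Q + Q *m dent (x *m Q) *m Q^T.

Local Notation g := hexagonal_metric.

Lemma elementary_dent : elementary_mx dent.
Proof.
move=> i j.
have -> : (fun x => dent x i j) =
    (fun x => x 0 0 ^+ 2 * mx2 (dent_x x) 0 0 (dent_y x) i j).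
  by apply/funext => x; rewrite mxE.
apply: elementary_mul; first by apply: elementary_pow; exact: elementary_coord.
by apply: (elementary_mx_diag elementary_dent_x elementary_dent_y).
Qed.

Lemma elementary_hexagonal : elementary_mx g.
Proof.
have ec := @elementary_mx_const R 2 2 2.
have eD L : elementary_mx (fun x => dent (x *m L)).
  by move=> i j; exact: (elementary_comp L (elementary_dent i j)).
apply: elementary_mx_add; last first.
  by apply: elementary_mulmx => //; apply: elementary_mulmx.
apply: elementary_mx_add; last first.
  by apply: elementary_mulmx => //; apply: elementary_mulmx.
by apply: elementary_mx_add => //; exact: elementary_dent.
Qed.

(** The cases that the eikonal equation of [phase] distinguishes: either the metric
    is that of the bump of this phase, or the phase has the differential of a
    linear function at x and the metric is, up to a rotation, that of another bump. *)
Lemma hexagonal_local x :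
  g x = 1%:M + dent x \/
  (profile x <= 0 /\ exists P, [/\ P = Q \/ P = Q^T,
     P^T *m P = 1%:M & g x = P^T *m (1%:M + dent (x *m P^T)) *m P]).
Proof.
have [h|h] := leP (profile x) 0; last first.
  left; have [h1 h2] := profile_rotation h.
  by rewrite /hexagonal_metric (dent_out h1) (dent_out h2) !(mulmx0, mul0mx) !addr0.
right; split=> //.
have [h1|h1] := leP (profile (x *m Q)) 0.
  exists Q; split; [by left|exact: rotation_tr_mul|].
  rewrite /hexagonal_metric (dent_out h) (dent_out h1) mulmx0 mul0mx !addr0.
  by rewrite mulmxDr mulmxDl mulmx1 rotation_tr_mul.
exists Q^T; rewrite trmxK; split; [by right|exact: rotation_mul_tr|].
rewrite /hexagonal_metric (dent_out h) (dent_out (x := x *m Q^T)); last first.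
  by have [] := profile_rotation h1; rewrite -mulmxA rotation_sqr.
rewrite mulmx0 mul0mx !addr0.
by rewrite mulmxDr mulmxDl mulmx1 rotation_mul_tr.
Qed.

Lemma hexagonal_gt0 x (v : 'rV[R]_2) : v != 0 -> 0 < (v *m g x *m v^T) 0 0.
Proof.
move=> v0; have [->|[_ [P [_ PP ->]]]] := hexagonal_local x; rewrite dented_metricE.
  exact: mx2_diag_gt0 (metric_x_gt0 x) (metric_y_gt0 x) v0.
have vP : v *m P^T != 0.
  by apply: contraNneq v0 => vP; rewrite -[v]mulmx1 -PP mulmxA vP mul0mx.
have := mx2_diag_gt0 (metric_x_gt0 (x *m P^T)) (metric_y_gt0 (x *m P^T)) vP.
by rewrite trmx_mul trmxK !mulmxA.
Qed.

Let hexagonal_unit x : g x \in unitmx := posdef_unitmx (hexagonal_gt0 x).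

Lemma dent_tr x : (dent x)^T = dent x.
Proof. by rewrite /dent linearZ/= mx2_tr. Qed.

Lemma hexagonal_sym x : (g x)^T = g x.
Proof.
by rewrite /hexagonal_metric !linearD/= trmx1 !trmx_mul !trmxK !dent_tr !mulmxA.
Qed.

Lemma hexagonal_rotation x : g x = Q^T *m g (x *m Q^T) *m Q.
Proof.
rewrite /hexagonal_metric.
have -> : x *m Q^T *m Q^T = x *m Q by rewrite -mulmxA rotation_tr_sqr.
have -> : x *m Q^T *m Q = x by rewrite -mulmxA rotation_tr_mul mulmx1.
rewrite !(mulmxDr, mulmxDl) mulmx1 rotation_tr_mul !mulmxA rotation_tr_mul mul1mx.
rewrite rotation_tr_sqr -[_ *m Q^T *m Q]mulmxA rotation_tr_mul mulmx1.
rewrite -[_ *m Q *m Q]mulmxA rotation_sqr.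
by rewrite -!addrA; congr (_ + _); rewrite addrC -addrA.
Qed.

Lemma hex_bump_mirror k x : hex_bump k (x *m mirror) = hex_bump k x.
Proof.
by rewrite /hex_bump /profile [x]rv2E rv2M !mxE /=; congr flat_exp; ring.
Qed.

Lemma mirrorE x : x *m mirror = rv2 (- x 0 0) (x 0 1).
Proof. by rewrite {1}[x]rv2E rv2M; congr rv2; ring. Qed.

Lemma slope_x_mirror x : p (x *m mirror) = p x.
Proof. by rewrite /slope_x !hex_bump_mirror mirrorE !mxE/=; ring. Qed.

Lemma slope_y_mirror x : q (x *m mirror) = - q x.
Proof. by rewrite /slope_y !hex_bump_mirror mirrorE !mxE/=; ring. Qed.

Lemma dent_mirror x : dent (x *m mirror) = mirror *m dent x *m mirror.
Proof.
have -> : dent (x *m mirror) = dent x.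
  rewrite /dent /dent_x /dent_y /excess /= !hex_bump_mirror slope_x_mirror slope_y_mirror.
  by rewrite mirrorE !mxE/= !sqrrN.
rewrite /dent -scalemxAr -scalemxAl; congr (_ *: _).
by rewrite !mx2M; congr mx2; ring.
Qed.

Lemma hexagonal_mirror x : g (x *m mirror) = mirror *m g x *m mirror.
Proof.
rewrite /hexagonal_metric -[x *m mirror *m _]mulmxA mirror_rotation_tr mulmxA.
rewrite -[x *m mirror *m _]mulmxA mirror_rotation mulmxA !dent_mirror.
rewrite !(mulmxDr, mulmxDl) mulmx1 mirror_mul !mulmxA.
rewrite mirror_rotation_tr mirror_rotation -!addrA; congr (_ + (_ + _)).
rewrite addrC; congr (_ + _).
  rewrite -!mulmxA; congr (_ *m (_ *m (_ *m _))).
  by rewrite mirror_rotation_tr.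
rewrite -!mulmxA; congr (_ *m (_ *m (_ *m _))).
exact: mirror_rotation.
Qed.

(** On the bump of the phase this is the first, elsewhere the second of the two
    equations that define [metric_x] and [metric_y]. *)
Lemma phase_eikonal x :
  (rv2 (p x) (q x) *m (gradient_field g phase x)^T) 0 0 = 1.
Proof.
have [gx|[h [P [PQ PP gx]]]] := hexagonal_local x; rewrite dented_metricE in gx.
  have A0 := metric_x_gt0 x; have B0 := metric_y_gt0 x.
  rewrite (@gradient_fieldP _ _ g phase x (rv2 (p x / metric_x x) (q x / metric_y x)))//;
    last first.
    rewrite gx rv2M gradient_phase !mulr0 addr0 add0r !divfK ?gt_eqF//.
  rewrite rv2_dot /metric_x /metric_y.
  have := slope_x_den x; have := slope_y_den x; have := slope_num x => *.
  by field; rewrite !gt_eqF.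
set y := x *m P^T in gx.
have A0 := metric_x_gt0 y; have B0 := metric_y_gt0 y.
have [c [d [cdE c2 d2]]] : exists c d, [/\ rv2 1 0 *m P^T = rv2 c d,
    c ^+ 2 = 1 / 4 & d ^+ 2 = 3 / 4].
  have r3 := @sqrt3_sqr R; case: PQ => ->.
    rewrite rotation_tr rv2M; eexists; eexists; split; [reflexivity|lra|].
    by move: r3; set r := Num.sqrt _ => r3; lra.
  rewrite trmxK /rotation rv2M; eexists; eexists; split; [reflexivity|lra|].
  by move: r3; set r := Num.sqrt _ => r3; lra.
have PP' := mulmx1C PP.
rewrite (@gradient_fieldP _ _ g phase x (rv2 (c / metric_x y) (d / metric_y y) *m P))//;
  last first.
  rewrite gx gradient_phase slope_x_out// slope_y_out// !mulmxA.
  rewrite -[_ *m P *m P^T]mulmxA PP' mulmx1 rv2M !mulr0 addr0 add0r.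
  by rewrite !divfK ?gt_eqF// -cdE -mulmxA PP mulmx1.
rewrite slope_x_out// slope_y_out// trmx_mul mulmxA cdE rv2_dot.
have -> : c * (c / metric_x y) + d * (d / metric_y y) =
  c ^+ 2 / metric_x y + d ^+ 2 / metric_y y by ring.
rewrite c2 d2 /metric_x /metric_y.
have := slope_x_den y; have := slope_y_den y; have := slope_num y => *.
by field; rewrite !gt_eqF.
Qed.

Lemma hexagonal_euclidean : euclidean_outside (box 10) g.
Proof.
move=> x xK; rewrite /hexagonal_metric (dent_out (x := x)); last first.
  by rewrite -[x]mulmx1; apply: profile_far => //; rewrite trmx1 mulmx1.
rewrite !dent_out ?mulmx0 ?mul0mx ?addr0//; apply: profile_far => //.
  exact: rotation_mul_tr.
by rewrite trmxK rotation_tr_mul.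
Qed.

(** The rotated phase x |-> phase (x P^T) satisfies the eikonal equation by the
    rotational symmetry of the metric, and the reflection P^T mirror P reverses its
    gradient field by the mirror symmetry. *)
Lemma hexagonal_direction P : P *m P^T = 1%:M ->
  (forall x, g x = P^T *m g (x *m P^T) *m P) ->
  invisible_direction g (box 10) (rv2 1 0 *m P).
Proof.
move=> PP' gP; have PP := mulmx1C PP'.
pose S x := phase (x *m P^T).
have eS : elementary S := elementary_comp _ elementary_phase.
have dS x : \row_k partial k S x =
    rv2 (p (x *m P^T)) (q (x *m P^T)) *m P.
  apply/rowP => i; rewrite mxE (partial_comp _ _ _ elementary_phase) mxE.
  by apply: eq_bigr => j _; rewrite mulrC -gradient_phase !mxE.
have XP x : gradient_field g S x = gradient_field g phase (x *m P^T) *m P.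
  apply: gradient_fieldP => //.
  rewrite gP !mulmxA -[_ *m P *m P^T]mulmxA PP' mulmx1 gradient_field_mul//.
  by rewrite gradient_phase dS.
have Xmirror y : gradient_field g phase (y *m mirror) =
    - (gradient_field g phase y *m mirror).
  apply: gradient_fieldP => //.
  rewrite hexagonal_mirror mulNmx !mulmxA -[_ *m mirror *m mirror]mulmxA mirror_mul.
  rewrite mulmx1 gradient_field_mul// !gradient_phase slope_x_mirror slope_y_mirror.
  by rewrite mirrorE; apply/rowP => j; rewrite !mxE; case: ifP => _; rewrite ?opprK.
have far x : ~ box 10 x -> profile (x *m P^T) <= 0.
  by apply: profile_far; rewrite trmxK.
have e1 : rv2 1 0 *m mirror = - rv2 1 0 :> 'rV[R]_2.
  by rewrite mirrorE; apply/rowP => j; rewrite !mxE/=; case: ifP => _; rewrite ?oppr0.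
have eikonal x : \sum_k partial k S x * gradient_field g S x 0 k = 1.
  rewrite row_dot dS XP trmx_mul mulmxA -[_ *m P *m P^T]mulmxA PP' mulmx1.
  exact: phase_eikonal.
apply: (@mirror_direction _ _ _ _ _ elementary_hexagonal hexagonal_sym
  hexagonal_unit eS eikonal (box 10) 10 _ (P^T *m mirror *m P)) => //.
- apply/eqP => /(congr1 (mulmx^~ P^T)); rewrite -mulmxA PP' mulmx1 mul0mx.
  by move=> /rowP/(_ 0); rewrite !mxE/= => /eqP; rewrite oner_eq0.
- move=> x xK; apply: gradient_fieldP => //.
  by rewrite hexagonal_euclidean// mulmx1 dS slope_x_out ?slope_y_out// far.
- move=> x xK; rewrite /S /phase hex_bump_out ?far// mulr0 addr0.
  by rewrite trmx_mul mulmxA [x *m P^T]rv2E rv2_dot !mxE/= mulr1 mulr0 addr0.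
- move=> x; rewrite !XP !mulmxA -[_ *m P *m P^T]mulmxA PP' mulmx1 Xmirror mulNmx.
  by rewrite -[in RHS](mulmxA _ P P^T) PP' mulmx1.
- move=> x; rewrite /S /phase; set y := x *m P^T => Sy.
  (* phase y = y_0 (1 + eps (y_0)^2 b), and the second factor is positive. *)
  have y0 : y 0 0 = 0.
    have : y 0 0 * (1 + eps * y 0 0 ^+ 2 * hex_bump 0 y) = 0 by rewrite -[RHS]Sy; ring.
    move=> /eqP; rewrite mulf_eq0 => /orP[/eqP//|].
    have : 0 <= eps * y 0 0 ^+ 2 * hex_bump 0 y.
      by rewrite mulr_ge0 ?flat_exp_ge0// mulr_ge0 ?sqr_ge0// ltW.
    by move=> ? /eqP; lra.
  rewrite !mulmxA -/y mirrorE y0 oppr0 -[in X in rv2 X]y0 -rv2E.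
  by rewrite /y -mulmxA PP mulmx1.
- by rewrite !mulmxA -[_ *m P *m P^T]mulmxA PP' mulmx1 e1 mulNmx.
- move=> x; exists (- 2 * (x *m P^T) 0 0); rewrite !mulmxA; set y := x *m P^T.
  have -> : y *m mirror = y + (- 2 * y 0 0) *: rv2 1 0.
    rewrite mirrorE; apply/rowP => j; rewrite !mxE.
    by case: (I2P j) => -> /=; ring.
  by rewrite mulmxDl -scalemxAl /y -mulmxA PP mulmx1.
Qed.

(** Near the centre of the first bump the rotated dents vanish. *)
Lemma hexagonal_curvature :
  riemann_curvature g 0 1 0 1 (rv2 0 2) = 2 * expR (-1) * eps.
Proof.
pose x0 : 'rV[R]_2 := rv2 0 2.
have px0 : profile x0 = 1 by rewrite /profile !mxE/= subrr expr0n subr0 subr0.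
have near_pos : \forall x \near x0, 0 < profile x.
  have cp := @elementary_continuous _ _ _ elementary_profile x0.
  by apply: (cvgr_gt _ cp); rewrite px0.
have near_g : \forall x \near x0, g x = 1%:M + dent x.
  apply: filterS near_pos => x xp; have [h1 h2] := profile_rotation xp.
  by rewrite /hexagonal_metric (dent_out h1) (dent_out h2) !(mulmx0, mul0mx) !addr0.
rewrite (near_riemann_curvature _ _ _ _ near_g).
have eI : elementary_mx (fun x => 1%:M + dent x).
  by apply: elementary_mx_add; [exact: elementary_mx_const|exact: elementary_dent].
have uI x : 1%:M + dent x \in unitmx.
  apply: posdef_unitmx => v; rewrite dented_metricE.
  exact: mx2_diag_gt0 (metric_x_gt0 x) (metric_y_gt0 x).
have x00 : x0 0 0 = 0 by rewrite mxE.
rewrite (riemann_curvature_ridge eI uI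
  (elementary_mx_diag elementary_dent_x elementary_dent_y) (fun=> erefl) x00)//.
have b0 : hex_bump 0 x0 = expR (-1).
  by rewrite /hex_bump /flat_exp px0 ltr01 expr0 mul1r invr1.
rewrite mxE/= /dent_y opprK /excess /slope_x -/x0 x00 b0 /=.
by field.
Qed.

End HexagonalMetric.

Lemma hexagonal_family (R : realType) : invisible_family (R := R) 2 3.
Proof.
pose g (s : R) := hexagonal_metric (amplitude s).
have a0 (s : R) := amplitude_gt0 s; have a1 (s : R) := amplitude_le s.
have e0 : 2 * expR (-1) != 0 :> R by rewrite mulf_neq0// gt_eqF ?expR_gt0.
have [gI gN] := family_of_curvature
  (fun s => hexagonal_curvature (a0 s) (a1 s)) e0.
pose Q := @rotation R.
exists (box 10), g; split; first exact: box_compact.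
split=> // s; split=> //.
- apply: riemannian_elementary; first exact: elementary_hexagonal.
    by move=> x; exact: hexagonal_sym.
  by move=> x v; exact: hexagonal_gt0.
- exact: hexagonal_euclidean.
- exact: gN.
pose P (i : 'I_3) : 'M[R]_2 := nth 1%:M [:: 1%:M; Q; Q^T] i.
exists (fun i => rv2 1 0 *m P i); split.
  move=> i; apply: (hexagonal_direction (a0 s) (a1 s)).
    case: i => [[|[|[|//]]] Hi]; rewrite /P /=.
    - by rewrite trmx1 mulmx1.
    - exact: rotation_mul_tr.
    - by rewrite trmxK rotation_tr_mul.
  move=> x; case: i => [[|[|[|//]]] Hi]; rewrite /P /=.
  - by rewrite trmx1 mul1mx !mulmx1.
  - exact: hexagonal_rotation.
  rewrite trmxK; have := hexagonal_rotation (amplitude s) (x *m Q).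
  rewrite -[x *m Q *m Q^T]mulmxA rotation_mul_tr mulmx1 => ->.
  by rewrite !mulmxA rotation_mul_tr mul1mx -mulmxA rotation_mul_tr mulmx1.
have r0 : 0 < Num.sqrt 3 :> R by rewrite sqrtr_gt0.
have PE : exists a : 'I_3 -> R, exists b : 'I_3 -> R,
   (forall i, rv2 1 0 *m P i = rv2 (a i) (b i)) /\
   (forall i j, i != j -> a i * b j != a j * b i).
  exists (fun i => nth 0 [:: 1; - 2^-1; - 2^-1] i).
  exists (fun i => nth 0 [:: 0; Num.sqrt 3 / 2; - (Num.sqrt 3 / 2)] i).
  split.
    case=> [[|[|[|//]]] Hi]; rewrite /P /=.
    - by rewrite mx2_1 rv2M; congr rv2; ring.
    - by rewrite rv2M; congr rv2; ring.
    - by rewrite rotation_tr rv2M; congr rv2; ring.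
  case=> [[|[|[|//]]] Hi]; case=> [[|[|[|//]]] Hj] //= _; apply/eqP; nra.
have [a [b [PEab ab]]] := PE.
move=> i j /ab /eqP nab [c _]; rewrite !PEab => E.
have := congr1 (fun v : 'rV_2 => v 0 0) E; rewrite !mxE/= => aj.
have := congr1 (fun v : 'rV_2 => v 0 1) E; rewrite !mxE/= => bj.
by apply: nab; rewrite aj bj; ring.
Qed.

Theorem theorem1p1 (R : realType) (n : nat) (hn : (1 < n)%N) :
  exists (K : set 'rV[R]_n) (g : R -> 'rV[R]_n -> 'M[R]_n),
    compact K /\ injective g /\
    forall s : R,
      [/\ riemannian_metric (g s),
          euclidean_outside K (g s),
          ~ flat (g s)
        & exists v : 'I_((n * n.+1) %/ 2) -> 'rV[R]_n,
            (forall i, invisible_direction (g s) K (v i)) /\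
            (forall i j, i != j -> ~ parallel (v i) (v j))].
Proof.
case: n hn => [|[|[|m]]] // _; first exact: hexagonal_family.
exact: (@straight_family R m.+3 0 1 ord_max).
Qed.
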